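(* Let $Q$ be a finite quiver, $k=\mathbb{F}_q$, $\mu$ a slope function, $\alpha$ a non-zero dimension vector and $\gamma$ a dimension vector with $0\le\gamma\le\alpha$. Then $$\sum_{[M]}\frac{|\mathrm{Gr}_\gamma(M)|}{a_M}=\sum_{*}\sum_{*'}(-1)^{s-1}\prod_{1\le i<j\le s}\frac{\langle\gamma_i,\beta_j\rangle}{\langle\alpha_i,\alpha_j\rangle}\prod_{k=1}^{s}r_{\beta_k,\gamma_k}(q),$$ where the left sum runs over the isomorphism classes of $\mu$-semi-stable representations $M$ of $Q$ over $\mathbb{F}_q$ of dimension vector $\alpha$; the sum $*$ runs over all decompositions $\alpha_1+\cdots+\alpha_s=\alpha$ ($s\ge 1$) of $\alpha$ into non-zero dimension vectors such that $\mu(\sum_{l=1}^{k}\alpha_l)<\mu(\alpha)$ for all $k<s$; and the sum $*'$ runs over all decompositions $\gamma_1+\cdots+\gamma_s=\gamma$ into dimension vectors such that $0\le\gamma_i\le\alpha_i$ for each $i$, with $\beta_i:=\alpha_i-\gamma_i$.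
   Context: $Q$ has vertex set $Q_0$, arrow set $Q_1$; an arrow $a$ goes from $ta$ to $ha$. Dimension vectors are elements of $\mathbb{Z}_{\ge0}^{Q_0}$, compared coordinatewise. The additive Euler form is $\langle\alpha,\beta\rangle_a=\sum_{v}\alpha(v)\beta(v)-\sum_{a\in Q_1}\alpha(ta)\beta(ha)$ and $\langle\alpha,\beta\rangle:=q^{\langle\alpha,\beta\rangle_a}$. $a_M:=|\mathrm{Aut}_Q(M)|$; $\mathrm{Gr}_\gamma(M)$ is the set of subrepresentations of $M$ of dimension vector $\gamma$. A weight is an integral linear functional on $\mathbb{Z}^{Q_0}$. A slope function is $\mu=\sigma/\theta$ with $\sigma,\theta$ weights and $\theta(\alpha)>0$ for all non-zero dimension vectors $\alpha$. A representation $M$ is $\mu$-semi-stable if $\mu(\underline{\dim}L)\le\mu(\underline{\dim}M)$ for every non-zero subrepresentation $L\subset M$. $r_\alpha(q):=\frac{|\mathrm{Rep}_\alpha(Q)|}{|\mathrm{GL}_\alpha|}$, where $\mathrm{Rep}_\alpha(Q)=\bigoplus_{a\in Q_1}\mathrm{Hom}(k^{\alpha(ta)},k^{\alpha(ha)})$ and $\mathrm{GL}_\alpha=\prod_{v}\mathrm{GL}_{\alpha(v)}(k)$; and $r_{\beta,\gamma}(q):=\langle\beta,\gamma\rangle^{-1}r_\beta(q)r_\gamma(q)$. *)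

(* Defs.v *)
From HB Require Import structures.
From mathcomp Require Import all_boot all_order all_algebra.

Set Implicit Arguments.
Unset Strict Implicit.
Unset Printing Implicit Defensive.

Import Order.TTheory GRing.Theory Num.Theory.
Local Open Scope ring_scope.

Record quiver := Quiver {
  vertex : finType;
  arrow : finType;
  tail : arrow -> vertex;
  head : arrow -> vertex
}.

Notation dimvec Q := {ffun vertex Q -> nat}.

Section DimensionVectors.
Variable Q : quiver.
Implicit Types (alpha beta gamma : dimvec Q).

Definition dv_le gamma alpha : bool := [forall v, (gamma v <= alpha v)%N].

(* Coordinatewise truncated subtraction; only used when gamma <= alpha. *)
Definition dv_sub alpha gamma : dimvec Q := [ffun v => (alpha v - gamma v)%N].

Definition dv_total alpha : nat := (\sum_v alpha v)%N.

Definition dv_int alpha : {ffun vertex Q -> int} := [ffun v => (alpha v)%:Z].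

Definition euler_a alpha beta : int :=
  \sum_v (alpha v)%:Z * (beta v)%:Z
  - \sum_(a : arrow Q) (alpha (tail a))%:Z * (beta (head a))%:Z.

End DimensionVectors.

(* Additive maps between abelian groups are the same as Z-linear ones. *)
Definition weight (Q : quiver) := {additive {ffun vertex Q -> int} -> int}.

Record slope (Q : quiver) := Slope {
  slope_num : weight Q;
  slope_den : weight Q;
  slope_den_gt0 :
    forall beta : dimvec Q, beta != 0 -> 0 < slope_den (dv_int beta)
}.

Definition slope_val (Q : quiver) (mu : slope Q) (alpha : dimvec Q) : rat :=
  (slope_num mu (dv_int alpha))%:Q / (slope_den mu (dv_int alpha))%:Q.
Coercion slope_val : slope >-> Funclass.

Section Representations.
Variables (Q : quiver) (F : finFieldType).
Implicit Types (alpha beta gamma : dimvec Q).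

(* Vectors are row vectors: the arrow a acts by x |-> x *m M a. *)
Definition rep alpha : finType :=
  {dffun forall a : arrow Q, 'M[F]_(alpha (tail a), alpha (head a))}.

Definition vmx alpha : finType :=
  {dffun forall v : vertex Q, 'M[F]_(alpha v)}.

Definition GLv alpha : {set vmx alpha} :=
  [set g : vmx alpha | [forall v, g v \in unitmx]].

Definition is_hom alpha (M N : rep alpha) (g : vmx alpha) : bool :=
  [forall a, M a *m g (head a) == g (tail a) *m N a].

Definition rep_iso alpha (M N : rep alpha) : bool :=
  [exists g in GLv alpha, is_hom M N g].

(* Makes equivalence_partition meaningful in iso_reps below. *)
Lemma rep_iso_equiv alpha : equivalence_rel (@rep_iso alpha).
Proof.
have refl M : @rep_iso alpha M M.
  apply/existsP; exists [ffun v => 1%:M]; rewrite inE; apply/andP; split.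
    by apply/forallP => v; rewrite ffunE unitmx1.
  by apply/forallP => a; rewrite !ffunE mulmx1 mul1mx.
have sym M N : @rep_iso alpha M N -> rep_iso N M.
  case/existsP => g /andP[]; rewrite inE => /forallP gu /forallP gh.
  apply/existsP; exists [ffun v => invmx (g v)]; rewrite inE.
  apply/andP; split; first by apply/forallP => v; rewrite ffunE unitmx_inv gu.
  apply/forallP => a; rewrite !ffunE; apply/eqP.
  by rewrite -[N a](mulKmx (gu (tail a))) -(eqP (gh a)) !mulmxA mulmxK ?gu.
have trans M N P : @rep_iso alpha M N -> rep_iso N P -> rep_iso M P.
  case/existsP => g /andP[]; rewrite inE => /forallP gu /forallP gh.
  case/existsP => f /andP[]; rewrite inE => /forallP fu /forallP fh.
  apply/existsP; exists [ffun v => g v *m f v]; rewrite inE.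
  apply/andP; split; first by apply/forallP => v; rewrite ffunE unitmx_mul gu fu.
  apply/forallP => a; rewrite !ffunE; apply/eqP.
  by rewrite mulmxA (eqP (gh a)) -!mulmxA (eqP (fh a)).
move=> M N P; split=> // MN; apply/idP/idP; last exact: trans.
by apply: trans; apply: sym.
Qed.

(* One representation from each isomorphism class of dimension alpha. *)
Definition iso_reps alpha : {set rep alpha} :=
  transversal (equivalence_partition (@rep_iso alpha) setT) setT.

Definition aut_card alpha (M : rep alpha) : nat :=
  #|[set g in GLv alpha | is_hom M M g]|.

(* L v stands for its row space; requiring L v = <<L v>> makes each subspace
   of F^(alpha v) correspond to exactly one matrix, so that subrepresentations
   are counted without repetition. *)
Definition is_subrep alpha (M : rep alpha) (L : vmx alpha) : bool :=
  [forall v, L v == <<L v>>%MS] &&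
  [forall a, (L (tail a) *m M a <= L (head a))%MS].

Definition subrep_dim alpha (L : vmx alpha) : dimvec Q :=
  [ffun v => \rank (L v)].

Definition semistable (mu : slope Q) alpha (M : rep alpha) : bool :=
  [forall L : vmx alpha,
     is_subrep M L && (subrep_dim L != 0) ==> (mu (subrep_dim L) <= mu alpha)].

Definition Gr gamma alpha (M : rep alpha) : {set vmx alpha} :=
  [set L | is_subrep M L & subrep_dim L == gamma].

Definition euler alpha beta : rat := #|F|%:R ^ euler_a alpha beta.

Definition r1 alpha : rat := #|rep alpha|%:R / #|GLv alpha|%:R.

Definition r2 beta gamma : rat := (euler beta gamma)^-1 * r1 beta * r1 gamma.

End Representations.

Section Decompositions.
Variable Q : quiver.
Implicit Types (alpha gamma : dimvec Q).

(* The dimension vectors bounded by alpha, as a finite type. *)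
Definition subdim alpha : finType :=
  {dffun forall v : vertex Q, 'I_(alpha v).+1}.

Definition dv_of alpha (d : subdim alpha) : dimvec Q :=
  [ffun v => nat_of_ord (d v)].

(* Indices run over 'I_s, i.e. are shifted by one: the sum over l < k has k
   terms, and k ranges over 0 < k < s. *)
Definition admissible (mu : slope Q) alpha s
    (d : {ffun 'I_s -> subdim alpha}) : bool :=
  [&& \sum_(i < s) dv_of (d i) == alpha,
      [forall i, dv_of (d i) != 0] &
      [forall k : 'I_s, (0 < k)%N ==>
         (mu (\sum_(l < s | (l < k)%N) dv_of (d l)) < mu alpha)]].

Definition compatible alpha gamma s (d : {ffun 'I_s -> subdim alpha})
    (c : {ffun 'I_s -> subdim gamma}) : bool :=
  (\sum_(i < s) dv_of (c i) == gamma) && [forall i, dv_le (dv_of (c i)) (dv_of (d i))].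

(* Summing over s <= dv_total alpha and over parts bounded by alpha loses no
   decomposition of alpha. *)
Lemma decomposition_bounds alpha s (d : 'I_s -> dimvec Q) :
  \sum_(i < s) d i = alpha ->
  (forall i, dv_le (d i) alpha) /\
  ((forall i, d i != 0) -> (s <= dv_total alpha)%N).
Proof.
move=> <-.
have sumv v : (\sum_(i < s) d i : dimvec Q) v = (\sum_(i < s) d i v)%N.
  by rewrite sum_ffunE.
split=> [i|nz]; first by apply/forallP => v; rewrite sumv (bigD1 i) //= leq_addr.
rewrite /dv_total; under eq_bigr => v _ do rewrite sumv.
rewrite exchange_big /= -[X in (X <= _)%N]card_ord -sum1_card.
apply: leq_sum => i _; rewrite lt0n; apply: contra (nz i).
rewrite sum_nat_eq0 => /forallP z; apply/eqP/ffunP => v.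
by rewrite ffunE; apply/eqP; apply: (implyP (z v)).
Qed.

End Decompositions.

(* Main.v *)
From Stdlib Require Import FunctionalExtensionality.
Require Import Defs.
From mathcomp Require Import all_boot all_order all_algebra ring zify.

Set Implicit Arguments.
Unset Strict Implicit.
Unset Printing Implicit Defensive.

Import Order.TTheory GRing.Theory Num.Theory.
Local Open Scope ring_scope.

(** Let f(x) = sigma(x) theta(alpha) - sigma(alpha) theta(x), an additive
function of dimension vectors which vanishes at alpha and which, for x <> 0,
has the sign of mu(x) - mu(alpha).  Call a subrepresentation N of M
destabilizing if f(dim N) > 0, and let h(M) be the sum of (-1)^r over all
chains N_1 < ... < N_r < M of destabilizing subrepresentations.

The first point is that h(M) is 1 if M is semistable and 0 otherwise
([chain_sum_full]).  If M is semistable only the empty chain contributes.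
Otherwise let D maximize f(dim D).  Since
f(N) + f(D) = f(N + D) + f(N :&: D) and f(N + D) <= f(D), the
subrepresentation N :&: D is destabilizing as soon as N is, so
N >= N :&: D <= D contracts the poset of destabilizing subrepresentations and
its reduced Euler characteristic, which is -h(M), vanishes.

By orbit counting ([sum_iso_reps]) the left-hand side of the theorem is thus
1/|GL_alpha| times the sum of h(M) over all M in Rep_alpha and all L in
Gr_gamma(M).  The second point is that the right-hand side computes this sum
according to the dimension vectors of the chain and of the subquotients
induced on L.  Both sides satisfy the same recursion, obtained by splitting off
the largest member N of the chain, that is, the first part
alpha_1 = dim M/N of the decomposition ([pair_chain_sumS] for the
representations, [flag_sumS] for the decompositions).

The recursion rests on one count ([pair_sumE]): the pairs (N, L) of
subrepresentations for which dim N, dim L and dim (N :&: L) are prescribed.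
At each vertex such pairs of subspaces form a single GL-orbit, because a basis
of N :&: L extends to bases of N and of L whose union is independent
([frame_exists]).  Summing over pairs therefore amounts to summing over
invertible matrices g and dividing by the order of a stabilizer
([pair_sum_frames]); conjugation by g turns the arrows of M into block
matrices, with the blocks that would move N or L outside themselves equal to
zero.  As the stabilizer and the representations have the same zero blocks, the
diagonal blocks contribute the factors r and each remaining block a power of q
whose exponent is a value of the Euler form. *)

(** * Counting along bijections *)

Lemma reindex_bij (R : Type) (idx : R) (op : Monoid.com_law idx)
    (I J : finType) (h : I -> J) (h' : J -> I) (P : pred J) (Q : pred I)
    (G : J -> R) :
    (forall j, P j -> Q (h' j) /\ h (h' j) = j) ->
    (forall i, Q i -> P (h i) /\ h' (h i) = i) ->
  \big[op/idx]_(j | P j) G j = \big[op/idx]_(i | Q i) G (h i).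
Proof.
move=> PQ QP; rewrite (reindex_onto h h') => [|j /PQ[]//].
apply: eq_bigl => i; apply/andP/idP => [[/PQ[Q' _] /eqP <-] // | /QP[-> ->]].
by rewrite eqxx.
Qed.

Lemma card_bij (I J : finType) (h : I -> J) (h' : J -> I) (P : pred J)
    (Q : pred I) :
    (forall j, P j -> Q (h' j) /\ h (h' j) = j) ->
    (forall i, Q i -> P (h i) /\ h' (h i) = i) ->
  #|P| = #|Q|.
Proof. by move=> PQ QP; rewrite -!sum1_card (reindex_bij _ _ PQ QP). Qed.

Lemma card_dffun_pred (I : finType) (T : I -> finType) (P : forall i, pred (T i)) :
  #|[pred f : {dffun forall i, T i} | [forall i, P i (f i)]]|
  = (\prod_i #|P i|)%N.
Proof.
have -> : #|[pred f : {dffun forall i, T i} | [forall i, P i (f i)]]|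
          = #|(family P : simpl_pred {dffun forall i, T i})| by apply: eq_card.
by rewrite card_family foldrE big_map big_enum.
Qed.

(** * Block triangular matrices over a finite field *)

Section MatrixBlocks.
Variable F : finFieldType.

Definition lower_mx m1 m2 n1 n2 (X : 'M[F]_(m1 + m2, n1 + n2)) : bool :=
  ursubmx X == 0.

Lemma lower_mxE m1 m2 n1 n2 (X : 'M[F]_(m1 + m2, n1 + n2)) :
  lower_mx X -> X = block_mx (ulsubmx X) 0 (dlsubmx X) (drsubmx X).
Proof. by move/eqP=> X0; rewrite -{1}[X]submxK X0. Qed.

Lemma lower_block_mx m1 m2 n1 n2 A B C :
  lower_mx (block_mx A 0 B C : 'M[F]_(m1 + m2, n1 + n2)).
Proof. by rewrite /lower_mx block_mxKur. Qed.

Lemma card_lower_pred m1 m2 n1 n2 (PA : pred 'M[F]_(m1, n1))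
    (PB : pred 'M[F]_(m2, n1)) (PC : pred 'M[F]_(m2, n2)) :
  #|[pred X : 'M[F]_(m1 + m2, n1 + n2) |
      [&& lower_mx X, PA (ulsubmx X), PB (dlsubmx X) & PC (drsubmx X)]]|
  = (#|PA| * (#|PB| * #|PC|))%N.
Proof.
rewrite -!cardX.
apply: (card_bij
   (h := fun t : 'M_(m1, n1) * ('M_(m2, n1) * 'M_(m2, n2)) =>
           block_mx t.1 0 t.2.1 t.2.2)
   (h' := fun X => (ulsubmx X, (dlsubmx X, drsubmx X)))) => [X | [A [B C]]].
  by rewrite inE => /andP[/lower_mxE <- P]; rewrite !inE.
rewrite !inE /= block_mxKul block_mxKdl block_mxKdr => P.
by rewrite lower_block_mx.
Qed.

Lemma card_lower_mx m1 m2 n1 n2 :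
  #|[pred X : 'M[F]_(m1 + m2, n1 + n2) | lower_mx X]|
  = (#|F| ^ (m1 * n1 + m2 * n1 + m2 * n2))%N.
Proof.
have := @card_lower_pred m1 m2 n1 n2 predT predT predT.
rewrite !card_mx -!expnD addnA => <-.
by apply: eq_card => X; rewrite !inE !andbT.
Qed.

Lemma unitmx_lower n1 n2 (X : 'M[F]_(n1 + n2)) :
  lower_mx X -> (X \in unitmx) = (ulsubmx X \in unitmx) && (drsubmx X \in unitmx).
Proof. by move/lower_mxE=> {1}->; rewrite !unitmxE det_lblock unitrM. Qed.

Definition gl_card n := #|[pred X : 'M[F]_n | X \in unitmx]|.

Definition lower_gl_card n1 n2 :=
  #|[pred X : 'M[F]_(n1 + n2) | (X \in unitmx) && lower_mx X]|.

Lemma lower_gl_cardE n1 n2 :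
  lower_gl_card n1 n2 = (gl_card n1 * gl_card n2 * #|F| ^ (n2 * n1))%N.
Proof.
have := @card_lower_pred n1 n2 n1 n2 (mem unitmx) predT (mem unitmx).
rewrite card_mx mulnCA mulnC => <-.
apply: eq_card => X; rewrite !inE andbC.
by case lX: lower_mx => //=; rewrite unitmx_lower.
Qed.

(** The matrices that preserve, acting on rows, both the span N of blocks 1, 2
and the span L of blocks 1, 3: by [sub_std2_pair] their zero blocks are those
leading from N to blocks 3, 4 and from L to blocks 2, 4. *)
Definition pair_mx m1 m2 m3 m4 n1 n2 n3 n4
    (X : 'M[F]_((m1 + m2) + (m3 + m4), (n1 + n2) + (n3 + n4))) : bool :=
  [&& lower_mx X, lower_mx (ulsubmx X), lower_mx (dlsubmx X)
    & lower_mx (drsubmx X)].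

Lemma card_unit_pair_mx n1 n2 n3 n4 :
  #|[pred X : 'M[F]_((n1 + n2) + (n3 + n4)) | (X \in unitmx) && pair_mx X]|
  = (lower_gl_card n1 n2 *
     (#|F| ^ (n3 * n1 + n4 * n1 + n4 * n2) * lower_gl_card n3 n4))%N.
Proof.
rewrite -card_lower_mx -card_lower_pred; apply: eq_card => X; rewrite !inE /=.
rewrite /pair_mx; case lX: (lower_mx X); last by rewrite andbF.
rewrite unitmx_lower //= -!andbA; bool_congr.
by rewrite [LHS]andbCA; bool_congr; rewrite andbCA.
Qed.

(** The model of N, spanned by the first block of coordinates, and below it the
model of L, spanned by blocks 1 and 3 of four, so that N :&: L is spanned by
block 1. *)
Definition sub_std n' n1 : 'M[F]_(n', n' + n1) := row_mx 1%:M 0.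
Definition sub_std2 n1 n2 n3 n4 : 'M[F]_(n1 + n3, (n1 + n2) + (n3 + n4)) :=
  block_mx (sub_std n1 n2) 0 0 (sub_std n3 n4).

Lemma sub_sub_std m n' n1 (X : 'M[F]_(m, n' + n1)) :
  (X <= sub_std n' n1)%MS = (rsubmx X == 0).
Proof.
apply/submxP/eqP=> [[D ->] | X0]; first by rewrite mul_mx_row mulmx0 row_mxKr.
by exists (lsubmx X); rewrite mul_mx_row mulmx1 mulmx0 -X0 hsubmxK.
Qed.

Lemma sub_sub_std2 m n1 n2 n3 n4 (X : 'M[F]_(m, (n1 + n2) + (n3 + n4))) :
  (X <= sub_std2 n1 n2 n3 n4)%MS
  = (rsubmx (lsubmx X) == 0) && (rsubmx (rsubmx X) == 0).
Proof.
apply/submxP/andP=> [[D ->] | [/eqP X0 /eqP X1]].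
  rewrite -[D]hsubmxK mul_row_block !mulmx0 add0r addr0 row_mxKl row_mxKr.
  by rewrite !mul_mx_row !mulmx0 !row_mxKr eqxx.
exists (row_mx (lsubmx (lsubmx X)) (lsubmx (rsubmx X))).
rewrite mul_row_block !mulmx0 add0r addr0 !mul_mx_row !mulmx0 !mulmx1.
by rewrite -[LHS]hsubmxK -[lsubmx X in LHS]hsubmxK -[rsubmx X in LHS]hsubmxK X0 X1.
Qed.

Lemma sub_std_lower m' m1 n' n1 (X : 'M[F]_(m' + m1, n' + n1)) :
  (sub_std m' m1 *m X <= sub_std n' n1)%MS = lower_mx X.
Proof.
rewrite sub_sub_std /lower_mx -{1}[X]submxK mul_row_block !mul0mx !addr0.
by rewrite row_mxKr mul1mx.
Qed.

Lemma sub_std2_pair m1 m2 m3 m4 n1 n2 n3 n4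
    (X : 'M[F]_((m1 + m2) + (m3 + m4), (n1 + n2) + (n3 + n4))) :
  pair_mx X =
  (sub_std (m1 + m2) (m3 + m4) *m X <= sub_std (n1 + n2) (n3 + n4))%MS
  && (sub_std2 m1 m2 m3 m4 *m X <= sub_std2 n1 n2 n3 n4)%MS.
Proof.
rewrite sub_std_lower /pair_mx; case lX: (lower_mx X) => //=.
rewrite [X in sub_std2 _ _ _ _ *m X](lower_mxE lX) mulmx_block.
rewrite !mulmx0 !mul0mx !add0r !addr0 block_mxEv col_mx_sub !sub_sub_std2.
rewrite !row_mxKl !row_mxKr linear0 eqxx andbT -!sub_sub_std !sub_std_lower.
by rewrite andbA.
Qed.
End MatrixBlocks.

(** * Bases adapted to a pair of subspaces *)

Section Frames.
Variable F : finFieldType.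

Lemma rank_sub_std n' n1 : \rank (sub_std F n' n1) = n'.
Proof. by rewrite rank_row_mx0 mxrank1. Qed.

Lemma rank_sub_std2 n1 n2 n3 n4 : \rank (sub_std2 F n1 n2 n3 n4) = (n1 + n3)%N.
Proof. by rewrite rank_diag_block_mx !rank_sub_std. Qed.

Lemma cap_sub_std n1 n2 n3 n4 :
  (sub_std F (n1 + n2) (n3 + n4) :&: sub_std2 F n1 n2 n3 n4
   :=: row_mx (sub_std F n1 n2) 0)%MS.
Proof.
apply/eqmxP/andP; split; last first.
  rewrite sub_capmx sub_sub_std sub_sub_std2 row_mxKl !row_mxKr.
  by rewrite linear0 !eqxx.
set X := (X in (X <= _)%MS).
have /eqP X0 : rsubmx X == 0 by rewrite -sub_sub_std capmxSl.
have : (X <= sub_std2 F n1 n2 n3 n4)%MS by apply: capmxSr.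
rewrite sub_sub_std2 => /andP[X1 _].
move: X1; rewrite -sub_sub_std => /submxP[D XD].
rewrite -[X]hsubmxK X0 XD.
by apply/submxP; exists D; rewrite [RHS]mul_mx_row mulmx0.
Qed.

Section Square.
Variables n1 n2 n3 n4 : nat.
Let n := ((n1 + n2) + (n3 + n4))%N.
Implicit Types N L g : 'M[F]_n.

Definition pair_config N L : bool :=
  [&& N == <<N>>%MS, L == <<L>>%MS, \rank N == (n1 + n2)%N,
      \rank L == (n1 + n3)%N & \rank (N :&: L)%MS == n1].

Definition frame_sub g : 'M_n := <<sub_std F (n1 + n2) (n3 + n4) *m g>>%MS.
Definition frame_sub2 g : 'M_n := <<sub_std2 F n1 n2 n3 n4 *m g>>%MS.

Lemma pair_config_frame g :
  g \in unitmx -> pair_config (frame_sub g) (frame_sub2 g).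
Proof.
move=> gu; have gf : row_free g by rewrite row_free_unit.
rewrite /pair_config !genmx_id !eqxx !genmxE !mxrankMfree //.
rewrite rank_sub_std rank_sub_std2 !eqxx /=.
have -> : \rank (frame_sub g :&: frame_sub2 g)%MS =
          \rank ((sub_std F (n1 + n2) (n3 + n4) :&: sub_std2 F n1 n2 n3 n4)%MS *m g).
  rewrite mxrankMfree //; apply: (@addnI (\rank (frame_sub g + frame_sub2 g)%MS)).
  rewrite mxrank_sum_cap !genmxE !mxrankMfree // -mxrank_sum_cap; congr (_ + _)%N.
  rewrite -[LHS](mxrankMfree _ gf) (addsmxMr _ _ g).
  by apply/esym/eqmx_rank/eqmxP; apply: adds_eqmx; apply: genmxE.
by rewrite mxrankMfree // cap_sub_std rank_row_mx0 rank_sub_std.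
Qed.

Lemma row_base_of m (X : 'M[F]_(m, n)) k :
  \rank X = k -> exists B : 'M[F]_(k, n), (B :=: X)%MS.
Proof. by move=> <-; exists (row_base X); apply: eq_row_base. Qed.

(** All pairs of subspaces in the same relative position are GL-conjugate: bases
of N :&: L, of complements of it in N and in L, and of a complement of N + L
together form the rows of the required g. *)
Lemma frame_exists N L :
  pair_config N L ->
  exists g, [&& g \in unitmx, frame_sub g == N & frame_sub2 g == L].
Proof.
case/and5P=> /eqP defN /eqP defL /eqP rN /eqP rL /eqP rNL.
have rD : \rank (N :\: L)%MS = n2.
  by apply: (@addnI n1); rewrite -rN -(mxrank_cap_compl N L) rNL.
have rD' : \rank (L :\: N)%MS = n3.
  by apply: (@addnI n1); rewrite -rL -(mxrank_cap_compl L N) capmxC rNL.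
have rC : \rank ((N + L)^C)%MS = n4.
  rewrite mxrank_compl.
  have := mxrank_sum_cap N L; rewrite rN rL rNL => e.
  have -> : \rank (N + L)%MS = (n1 + n2 + n3)%N.
    by apply: (@addIn n1); rewrite e -!addnA [(n1 + n3)%N]addnC.
  by rewrite /n addnA addKn.
have [b1 e1] := row_base_of rNL; have [b2 e2] := row_base_of rD.
have [b3 e3] := row_base_of rD'; have [b4 e4] := row_base_of rC.
pose g := col_mx (col_mx b1 b2) (col_mx b3 b4) : 'M_n.
have gN : (sub_std F (n1 + n2) (n3 + n4) *m g :=: N)%MS.
  rewrite mul_row_col mul1mx mul0mx addr0; apply: eqmx_trans (eqmx_sym (addsmxE _ _)) _.
  apply: eqmx_trans (adds_eqmx e1 e2) _; rewrite addsmxC.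
  exact: addsmx_diff_cap_eq.
have gL : (sub_std2 F n1 n2 n3 n4 *m g :=: L)%MS.
  rewrite mul_block_col !mul0mx addr0 add0r !mul_row_col !mul1mx !mul0mx !addr0.
  apply: eqmx_trans (eqmx_sym (addsmxE _ _)) _.
  apply: eqmx_trans (adds_eqmx e1 e3) _; rewrite addsmxC capmxC.
  exact: addsmx_diff_cap_eq.
exists g; apply/and3P; split.
- rewrite -row_full_unit -sub1mx.
  have gNL : (N + L <= g)%MS by rewrite addsmx_sub -gN -gL !submxMl.
  have gC : ((N + L)^C <= g)%MS.
    rewrite -e4; apply: submx_trans (_ : col_mx b3 b4 <= g)%MS.
      by rewrite -addsmxE addsmxSr.
    by rewrite -(addsmxE (col_mx b1 b2)) addsmxSr.
  apply: submx_trans (_ : (N + L) + (N + L)^C <= g)%MS.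
    by rewrite sub1mx addsmx_compl_full.
  by rewrite addsmx_sub gNL.
- by apply/eqP; rewrite [RHS]defN; apply/genmxP/eqmxP.
- by apply/eqP; rewrite [RHS]defL; apply/genmxP/eqmxP.
Qed.

Lemma genmx_mul_unit m (S : 'M[F]_(m, n)) p g :
  p \in unitmx -> g \in unitmx ->
  (<<S *m (p *m g)>>%MS == <<S *m g>>%MS) = (S *m p <= S)%MS.
Proof.
move=> pu gu; have gf : row_free g by rewrite row_free_unit.
rewrite mulmxA -(submxMfree (S *m p) S gf).
apply/eqP/idP => [e | le]; first by rewrite -genmxE e genmxE.
apply/genmxP; rewrite -(mxrank_leqif_eq le) !mxrankMfree //.
by rewrite row_free_unit.
Qed.

(** The frames of a pair form a coset of its stabilizer, whence their number does
not depend on the pair. *)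
Lemma card_frames N L :
  pair_config N L ->
  #|[pred g : 'M[F]_n | [&& g \in unitmx, frame_sub g == N & frame_sub2 g == L]]|
  = #|[pred p : 'M[F]_n | (p \in unitmx) && pair_mx p]|.
Proof.
case/frame_exists=> g0 /and3P[g0u /eqP <- /eqP <-].
apply: (card_bij (h := fun p => p *m g0) (h' := fun g => g *m invmx g0)).
  move=> g /and3P[gu]; rewrite -{1}[g](mulmxKV g0u) -{2}[g](mulmxKV g0u).
  have pu : g *m invmx g0 \in unitmx by rewrite unitmx_mul gu unitmx_inv.
  rewrite /frame_sub /frame_sub2 !genmx_mul_unit // => sN sL.
  by rewrite mulmxKV // inE pu sub_std2_pair sN.
move=> p /andP[pu]; rewrite sub_std2_pair => /andP[sN sL].
rewrite mulmxK // inE unitmx_mul pu g0u /frame_sub /frame_sub2.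
by rewrite !genmx_mul_unit // sN.
Qed.

End Square.
End Frames.

(** * Representations and signed chain counts *)

Section QuiverRepresentations.
Variables (Q : quiver) (F : finFieldType).
Implicit Types n : vertex Q -> nat.

(** Dimensions are given here by plain functions on the vertices, so that a
representation of dimension n1 v + n2 v at v has block matrices without any
transport; at a dimension vector these types are [rep] and [vmx]. *)
Definition qrep n : finType :=
  {dffun forall a : arrow Q, 'M[F]_(n (tail a), n (Defs.head a))}.

Definition qmx n : finType := {dffun forall v : vertex Q, 'M[F]_(n v)}.

Definition canonical n (X : qmx n) : bool := [forall v, X v == <<X v>>%MS].

Definition subrep n (M : qrep n) (L : qmx n) : bool :=
  canonical L && [forall a, (L (tail a) *m M a <= L (Defs.head a))%MS].

Definition sdim n (L : qmx n) : dimvec Q := [ffun v => \rank (L v)].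

Definition qle n (X Y : qmx n) : bool := [forall v, (X v <= Y v)%MS].

Definition qunit n (g : qmx n) : bool := [forall v, g v \in unitmx].

Definition qfull n : qmx n := [ffun v => 1%:M].

Lemma canonicalP n (X Y : qmx n) :
  canonical X -> canonical Y -> (forall v, (X v :=: Y v)%MS) -> X = Y.
Proof.
move=> /forallP cX /forallP cY e; apply/ffunP => v.
by rewrite (eqP (cX v)) (eqP (cY v)); apply/genmxP/eqmxP.
Qed.

Lemma canonical_gen n m (X : forall v, 'M[F]_(m v, n v)) :
  canonical [ffun v => <<X v>>%MS].
Proof. by apply/forallP => v; rewrite ffunE genmx_id. Qed.

Lemma qle_anti n (X Y : qmx n) :
  canonical X -> canonical Y -> qle X Y -> qle Y X -> X = Y.
Proof.
move=> cX cY /forallP XY /forallP YX; apply: canonicalP => // v.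
by apply/eqmxP; rewrite XY YX.
Qed.

Section ChainSum.
Variable pos : pred (dimvec Q).

(** The sum of (-1)^r over the chains N_1 < ... < N_r < X of subrepresentations
whose dimension vectors satisfy [pos], for r < K: the recursion splits off the
largest member of a nonempty chain.  The bound K makes the recursion
structural; [chain_sum_stable] shows that it ceases to matter once K is large.
It corresponds exactly to bounding the number of parts of a decomposition by
K, which is why it is kept in the statements below. *)
Fixpoint chain_sum (K : nat) n (M : qrep n) (X : qmx n) : rat :=
  if K is K'.+1 then
    1 - \sum_(N | [&& subrep M N, qle N X, N != X & pos (sdim N)])
          chain_sum K' M N
  else 0.

(** An embedding iota of a representation A into M identifies the
subrepresentations of A with those of M that lie below the image of iota.  This
covers both a change of basis and the inclusion of a subrepresentation. *)
Section Embedding.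
Variables (n' n : vertex Q -> nat) (A : qrep n') (M : qrep n).
Variable iota : forall v, 'M[F]_(n' v, n v).
Hypothesis iota_free : forall v, row_free (iota v).
Hypothesis iota_hom : forall a, A a *m iota (Defs.head a) = iota (tail a) *m M a.

Definition push (X : qmx n') : qmx n := [ffun v => <<X v *m iota v>>%MS].
Definition pull (Y : qmx n) : qmx n' := [ffun v => <<Y v *m pinvmx (iota v)>>%MS].

Lemma pushK X : canonical X -> pull (push X) = X.
Proof.
move=> cX; apply: canonicalP => // [|v]; first exact: canonical_gen.
rewrite !ffunE; apply: eqmx_trans (genmxE _) _.
by apply: eqmx_trans (eqmxMr _ (genmxE _)) _; rewrite mulmxKp.
Qed.

Lemma pullK Y :
  canonical Y -> (forall v, (Y v <= iota v)%MS) -> push (pull Y) = Y.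
Proof.
move=> cY le; apply: canonicalP => // [|v]; first exact: canonical_gen.
rewrite !ffunE; apply: eqmx_trans (genmxE _) _.
by apply: eqmx_trans (eqmxMr _ (genmxE _)) _; rewrite mulmxKpV.
Qed.

Lemma qle_push X Y : qle (push X) (push Y) = qle X Y.
Proof. by apply: eq_forallb => v; rewrite !ffunE !genmxE submxMfree. Qed.

Lemma subrep_push X : canonical X -> subrep M (push X) = subrep A X.
Proof.
move=> cX; rewrite /subrep cX canonical_gen; apply: eq_forallb => a.
rewrite !ffunE genmxE (eqmxMr _ (genmxE _)) -mulmxA -iota_hom mulmxA.
by rewrite submxMfree.
Qed.

Lemma sdim_push X : sdim (push X) = sdim X.
Proof. by apply/ffunP => v; rewrite !ffunE genmxE mxrankMfree. Qed.

Lemma chain_sum_push K X :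
  canonical X -> chain_sum K A X = chain_sum K M (push X).
Proof.
elim: K X => //= K IH X cX; congr (_ - _).
have eqP N : canonical N ->
    [&& subrep M (push N), qle (push N) (push X), push N != push X
      & pos (sdim (push N))]
    = [&& subrep A N, qle N X, N != X & pos (sdim N)].
  move=> cN; rewrite subrep_push // qle_push sdim_push; congr [&& _, _, ~~ _ & _].
  by apply/eqP/eqP => [/(congr1 pull) | ->//]; rewrite !pushK.
rewrite [RHS](reindex_bij _ (h := push) (h' := pull)
  (Q := fun N => [&& subrep A N, qle N X, N != X & pos (sdim N)])).
- by apply: eq_bigr => N /and4P[/andP[cN _] _ _ _]; apply: IH.
- move=> Y PY; have /and4P[/andP[cY _] /forallP le _ _] := PY.
  have pY : push (pull Y) = Y.
    apply: pullK => // v; apply: submx_trans (le v) _.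
    by rewrite ffunE genmxE submxMl.
  by split=> //; rewrite -eqP ?pY //; apply: canonical_gen.
move=> N QN; have /and4P[/andP[cN _] _ _ _] := QN.
by split; [rewrite eqP | rewrite pushK].
Qed.

End Embedding.
End ChainSum.
End QuiverRepresentations.

(** * Counting pairs of subrepresentations by frames *)

Section FrameCount.
Variables (Q : quiver) (F : finFieldType) (pos : pred (dimvec Q)).
Implicit Types n : vertex Q -> nat.

Definition lower_rep n1 n2 (A : qrep F (fun v => n1 v + n2 v)%N) : bool :=
  [forall a, lower_mx (A a)].

Definition lower_chain_sum K n1 n2 : rat :=
  \sum_(A : qrep F (fun v => n1 v + n2 v)%N | lower_rep A)
    chain_sum pos K A (qfull F _).

(** For a pair (N, L) in M, the numbers c, b, c1, b1 are the dimensions of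
N :&: L, of N modulo it, of the image of L in M/N and of M/N modulo that
image. *)
Variables c b c1 b1 : vertex Q -> nat.

Definition pair_dim v : nat := ((c v + b v) + (c1 v + b1 v))%N.

Definition pair_rep (M : qrep F pair_dim) : bool :=
  [forall a, pair_mx (M a : 'M_(c _ + b _ + (c1 _ + b1 _),
                                 c _ + b _ + (c1 _ + b1 _)))].

Definition pair_qconfig (NL : qmx F pair_dim * qmx F pair_dim) : bool :=
  [forall v, pair_config (n1 := c v) (n2 := b v) (n3 := c1 v) (n4 := b1 v)
                (NL.1 v) (NL.2 v)].

Definition qframe (g : qmx F pair_dim) : qmx F pair_dim * qmx F pair_dim :=
  ([ffun v => frame_sub (n1 := c v) (n2 := b v) (n3 := c1 v) (n4 := b1 v) (g v)],
   [ffun v => frame_sub2 (n1 := c v) (n2 := b v) (n3 := c1 v) (n4 := b1 v) (g v)]).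

Definition stab_card : nat :=
  (\prod_v #|[pred p : 'M[F]_(c v + b v + (c1 v + b1 v)) |
               (p \in unitmx) && pair_mx p]|)%N.

Lemma pair_qconfig_frame g : qunit g -> pair_qconfig (qframe g).
Proof.
move/forallP=> gu; apply/forallP => v; rewrite !ffunE.
exact: (pair_config_frame (gu v)).
Qed.

Lemma card_qframes NL :
  pair_qconfig NL ->
  #|[pred g | qunit g && (qframe g == NL)]| = stab_card.
Proof.
case: NL => N L /forallP cNL; rewrite /stab_card.
under eq_bigr => v _ do rewrite -(card_frames (cNL v)).
rewrite -card_dffun_pred; apply: eq_card => g; rewrite !inE.
apply/andP/forallP => [[/forallP gu /eqP[<- <-]] v | gP].
  by rewrite inE gu !ffunE !eqxx.
split; first by apply/forallP => v; case/and3P: (gP v).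
by apply/eqP; congr (_, _); apply/ffunP => v; rewrite ffunE;
  case/and3P: (gP v) => _ /eqP ? /eqP ?.
Qed.

Definition sub_std_q : qmx F pair_dim :=
  [ffun v => <<sub_std F (c v + b v) (c1 v + b1 v)>>%MS].

Definition pair_sum K : rat :=
  \sum_(M : qrep F pair_dim)
    \sum_(NL | [&& pair_qconfig NL, subrep M NL.1 & subrep M NL.2])
      chain_sum pos K M NL.1.

Lemma subrep_pair_rep g (M M' : qrep F pair_dim) :
  qunit g ->
  (forall a, M' a *m g (Defs.head a) = g (tail a) *m M a) ->
  subrep M (qframe g).1 && subrep M (qframe g).2 = pair_rep M'.
Proof.
move=> /forallP gu e; have cN : canonical (qframe g).1 by apply: canonical_gen.
have cL : canonical (qframe g).2 by apply: canonical_gen.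
rewrite /subrep cN cL {cN cL} /=.
have gf v : row_free (g v) by rewrite row_free_unit gu.
have subE m (S : forall v, 'M[F]_(m v, pair_dim v)) a :
    (<<S (tail a) *m g (tail a)>> *m M a <= <<S (Defs.head a) *m g (Defs.head a)>>)%MS
    = (S (tail a) *m M' a <= S (Defs.head a))%MS.
  by rewrite genmxE (eqmxMr _ (genmxE _)) -mulmxA -e mulmxA submxMfree.
apply/andP/forallP => [[/forallP sN /forallP sL] a | pM].
  rewrite sub_std2_pair; move: (sN a) (sL a); rewrite !ffunE.
  by rewrite !(subE _ (fun v => sub_std F (c v + b v) (c1 v + b1 v)))
       !(subE _ (fun v => sub_std2 F (c v) (b v) (c1 v) (b1 v))) => ->.
split; apply/forallP => a; rewrite !ffunE.
  rewrite (subE _ (fun v => sub_std F (c v + b v) (c1 v + b1 v))).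
  by have := pM a; rewrite sub_std2_pair => /andP[].
rewrite (subE _ (fun v => sub_std2 F (c v) (b v) (c1 v) (b1 v))).
by have := pM a; rewrite sub_std2_pair => /andP[].
Qed.

(** Conjugation by g is a bijection from the representations for which the pair
framed by g consists of subrepresentations to the block representations; it
carries the framed N to the standard one. *)
Lemma chain_sum_frame K g :
  qunit g ->
  \sum_(M | subrep M (qframe g).1 && subrep M (qframe g).2)
    chain_sum pos K M (qframe g).1
  = \sum_(M | pair_rep M) chain_sum pos K M sub_std_q.
Proof.
move=> gu; have /forallP gu' := gu.
pose h (M' : qrep F pair_dim) : qrep F pair_dim :=
  [ffun a => invmx (g (tail a)) *m M' a *m g (Defs.head a)].
pose h' (M : qrep F pair_dim) : qrep F pair_dim :=
  [ffun a => g (tail a) *m M a *m invmx (g (Defs.head a))].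
have hK M' : h' (h M') = M'.
  by apply/ffunP => a; rewrite !ffunE -!mulmxA mulmxV ?gu' // mulmx1 mulKVmx ?gu'.
have h'K M : h (h' M) = M.
  by apply/ffunP => a; rewrite !ffunE -!mulmxA mulVmx ?gu' // mulmx1 mulKmx ?gu'.
have hE (M' : qrep F pair_dim) a : M' a *m g (Defs.head a) = g (tail a) *m h M' a.
  by rewrite ffunE !mulmxA mulmxV ?gu' // mul1mx.
rewrite (reindex_bij _ (h := h) (h' := h') (Q := pair_rep)) => [|M|M' pM].
- apply: eq_bigr => M' _.
  have -> : (qframe g).1 = push (fun v => g v) sub_std_q.
    apply/ffunP => v; rewrite !ffunE.
    by apply/esym/genmxP/eqmxP; apply: eqmxMr; apply: genmxE.
  apply/esym/chain_sum_push => [v|a|]; first by rewrite row_free_unit gu'.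
    exact: hE.
  exact: canonical_gen.
- rewrite (@subrep_pair_rep g M (h' M) gu) // => a.
  by rewrite -[in RHS](h'K M) hE.
by rewrite (@subrep_pair_rep g (h M') M' gu).
Qed.

Lemma pair_sum_frames K :
  pair_sum K * stab_card%:R =
  #|[pred g : qmx F pair_dim | qunit g]|%:R *
  \sum_(M | pair_rep M) chain_sum pos K M sub_std_q.
Proof.
rewrite /pair_sum (exchange_big_dep pair_qconfig) /= => [|M NL _ /and3P[]//].
rewrite mulr_suml -sum1_card natr_sum mulr_suml.
under [RHS]eq_bigr => g gu do rewrite mul1r -(chain_sum_frame K gu).
rewrite [RHS](partition_big qframe pair_qconfig) /= => [|g]; last first.
  exact: pair_qconfig_frame.
apply: eq_bigr => NL cNL; rewrite -(card_qframes cNL) mulrC.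
rewrite mulr_natl -sumr_const; apply: eq_big => g; first by rewrite !inE.
rewrite inE => /andP[gu /eqP <-].
by apply: eq_bigl => M; rewrite pair_qconfig_frame.
Qed.

End FrameCount.

(** * The Euler form and the value of the count *)

Section EulerForm.
Variables (Q : quiver) (F : finFieldType).
Implicit Types x y n : vertex Q -> nat.

Definition vertex_form x y : nat := (\sum_v x v * y v)%N.
Definition arrow_form x y : nat := (\sum_(a : arrow Q) x (tail a) * y (Defs.head a))%N.

Local Notation q := (#|F|%:R : rat).

Definition qeuler x y : rat := q ^+ vertex_form x y / q ^+ arrow_form x y.

Definition qgl_card n : nat := (\prod_v gl_card F (n v))%N.

Definition qr1 n : rat := q ^+ arrow_form n n / (qgl_card n)%:R.

Definition qr2 x y : rat := (qeuler x y)^-1 * qr1 x * qr1 y.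

Lemma card_qunit n : #|[pred g : qmx F n | qunit g]| = qgl_card n.
Proof. exact: card_dffun_pred. Qed.

Lemma q_neq0 : q != 0.
Proof. by rewrite pnatr_eq0 -lt0n; apply/card_gt0P; exists 0. Qed.

Lemma qgl_card_neq0 n : (qgl_card n)%:R != 0 :> rat.
Proof.
rewrite pnatr_eq0 -card_qunit -lt0n; apply/card_gt0P; exists (qfull F n).
by rewrite inE; apply/forallP => v; rewrite ffunE unitmx1.
Qed.

Lemma vertex_formDl x y z :
  vertex_form (fun v => x v + y v)%N z = (vertex_form x z + vertex_form y z)%N.
Proof. by rewrite -big_split; apply: eq_bigr => v _; rewrite mulnDl. Qed.

Lemma vertex_formDr x y z :
  vertex_form x (fun v => y v + z v)%N = (vertex_form x y + vertex_form x z)%N.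
Proof. by rewrite -big_split; apply: eq_bigr => v _; rewrite mulnDr. Qed.

Lemma arrow_formDl x y z :
  arrow_form (fun v => x v + y v)%N z = (arrow_form x z + arrow_form y z)%N.
Proof. by rewrite -big_split; apply: eq_bigr => v _; rewrite mulnDl. Qed.

Lemma arrow_formDr x y z :
  arrow_form x (fun v => y v + z v)%N = (arrow_form x y + arrow_form x z)%N.
Proof. by rewrite -big_split; apply: eq_bigr => v _; rewrite mulnDr. Qed.

Lemma qeulerDl x y z :
  qeuler (fun v => x v + y v)%N z = qeuler x z * qeuler y z.
Proof. by rewrite /qeuler vertex_formDl arrow_formDl !exprD mulf_div. Qed.

Lemma qeulerDr x y z :
  qeuler x (fun v => y v + z v)%N = qeuler x y * qeuler x z.
Proof. by rewrite /qeuler vertex_formDr arrow_formDr !exprD mulf_div. Qed.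

Lemma prod_lower_gl n1 n2 :
  (\prod_v lower_gl_card F (n1 v) (n2 v))%N =
  (qgl_card n1 * qgl_card n2 * #|F| ^ vertex_form n2 n1)%N.
Proof.
rewrite expn_sum -!big_split /=; apply: eq_bigr => v _.
exact: lower_gl_cardE.
Qed.

Lemma card_lower_arrows m1 m2 n1 n2 :
  #|[pred B : {dffun forall a : arrow Q,
                 'M[F]_(m1 (tail a) + m2 (tail a), n1 (Defs.head a) + n2 (Defs.head a))}
      | [forall a, lower_mx (B a)]]|
  = (#|F| ^ (arrow_form m1 n1 + arrow_form m2 n1 + arrow_form m2 n2))%N.
Proof.
rewrite (card_dffun_pred (fun a => @lower_mx F _ _ _ _)) /arrow_form.
rewrite -!big_split expn_sum /=.
by apply: eq_bigr => a _; apply: card_lower_mx.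
Qed.
End EulerForm.

Section PairSum.
Variables (Q : quiver) (F : finFieldType) (pos : pred (dimvec Q)).
Variables c b c1 b1 : vertex Q -> nat.

Local Notation q := (#|F|%:R : rat).

Definition normalized_chain_sum K n1 n2 : rat :=
  lower_chain_sum F pos K n1 n2 / (\prod_v lower_gl_card F (n1 v) (n2 v))%:R.

(** In a block representation the diagonal part on N is an arbitrary
representation of dimension c + b preserving the first c coordinates, and
[chain_sum] below N only sees this part.  The other two blocks are free
subject to their own zero pattern and contribute powers of q. *)
Lemma pair_rep_sum K :
  \sum_(M | pair_rep M) chain_sum pos K M (sub_std_q F c b c1 b1)
  = lower_chain_sum F pos K c b *
    (q ^+ (arrow_form c1 c + arrow_form b1 c + arrow_form b1 b) *
     q ^+ (arrow_form c1 c1 + arrow_form b1 c1 + arrow_form b1 b1)).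
Proof.
pose cross : finType := {dffun forall a : arrow Q,
  'M[F]_(c1 (tail a) + b1 (tail a), c (Defs.head a) + b (Defs.head a))}.
pose T := (qrep F (fun v => c v + b v)%N * 
  (cross * qrep F (fun v => c1 v + b1 v)%N))%type.
pose h (t : T) : qrep F (pair_dim c b c1 b1) :=
  [ffun a => block_mx (t.1 a) 0 (t.2.1 a) (t.2.2 a)].
pose h' (M : qrep F (pair_dim c b c1 b1)) : T :=
  ([ffun a => ulsubmx (M a)], ([ffun a => dlsubmx (M a)], [ffun a => drsubmx (M a)])).
pose lowc := [pred B : cross | [forall a, lower_mx (B a)]].
pose lowC := [pred C : qrep F (fun v => c1 v + b1 v)%N | lower_rep C].
rewrite (reindex_bij _ (h := h) (h' := h')
   (Q := fun t => lower_rep t.1 && (t.2 \in [predX lowc & lowC]))).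
- have cs t : chain_sum pos K (h t) (sub_std_q F c b c1 b1)
              = chain_sum pos K t.1 (qfull F _).
    have -> : sub_std_q F c b c1 b1 =
              push (fun v => sub_std F (c v + b v) (c1 v + b1 v)) (qfull F _).
      by apply/ffunP => v; rewrite !ffunE mul1mx.
    apply/esym/chain_sum_push => [v|a|].
    + by rewrite /row_free rank_sub_std.
    + by rewrite ffunE mul_row_block mul_mx_row !mulmx0 !mul0mx !addr0 mul1mx mulmx1.
    by apply/forallP => v; rewrite ffunE genmx1.
  under eq_bigr => t _ do rewrite cs.
  rewrite -(pair_big (@lower_rep Q F c b) (fun t => t \in [predX lowc & lowC])
     (fun A _ => chain_sum pos K A (qfull F _))) /=.
  under eq_bigr => A _ do rewrite sumr_const -mulr_natr.
  rewrite -mulr_suml; congr (_ * _); rewrite cardX natrM -!natrX.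
  by congr (_%:R * _%:R); apply: card_lower_arrows.
- move=> M /forallP pM; split.
    apply/andP; split; first by apply/forallP => a; rewrite ffunE; case/and4P: (pM a).
    by rewrite !inE /=; apply/andP; split; apply/forallP => a; rewrite ffunE;
       case/and4P: (pM a).
  by apply/ffunP => a; rewrite !ffunE; case/and4P: (pM a) => /lower_mxE.
move=> [A [B C]]; rewrite !inE /= => /andP[/forallP lA /andP[/forallP lB /forallP lC]].
split.
  apply/forallP => a; rewrite ffunE /pair_mx lower_block_mx.
  by rewrite block_mxKul block_mxKdl block_mxKdr lA lB lC.
by congr (_, (_, _)); apply/ffunP => a;
  rewrite !ffunE /= ?block_mxKul ?block_mxKdl ?block_mxKdr.
Qed.

Lemma stab_cardE :
  stab_card F c b c1 b1 =
  (\prod_v lower_gl_card F (c v) (b v) *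
   (#|F| ^ (vertex_form c1 c + vertex_form b1 c + vertex_form b1 b) *
    \prod_v lower_gl_card F (c1 v) (b1 v)))%N.
Proof.
rewrite -!big_split expn_sum -!big_split /=; apply: eq_bigr => v _.
exact: card_unit_pair_mx.
Qed.

(** The exponents of q coming from the arrows count blocks of representations,
those from the vertices count the same blocks of the stabilizer; their
differences are the values of the Euler form on the right. *)
Lemma pair_sumE K :
  pair_sum F pos c b c1 b1 K / (qgl_card F (pair_dim c b c1 b1))%:R
  = qeuler F c1 b / qeuler F (fun v => c1 v + b1 v)%N (fun v => c v + b v)%N
    * qr2 F b1 c1 * normalized_chain_sum K c b.
Proof.
have := pair_sum_frames F pos c b c1 b1 K.
rewrite pair_rep_sum stab_cardE card_qunit /normalized_chain_sum.
rewrite !prod_lower_gl /qr2 /qr1 qeulerDl !qeulerDr /qeuler !natrM !natrX !exprD.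
have := q_neq0 F; have := qgl_card_neq0 F (pair_dim c b c1 b1).
have := qgl_card_neq0 F c; have := qgl_card_neq0 F b.
have := qgl_card_neq0 F c1; have := qgl_card_neq0 F b1.
set L := lower_chain_sum _ _ _ _ _.
move: (pair_sum _ _ _ _ _ _ _) => S.
move: ((qgl_card F (pair_dim c b c1 b1))%:R : rat) ((qgl_card _ c)%:R : rat)
  ((qgl_card _ b)%:R : rat) ((qgl_card _ c1)%:R : rat) ((qgl_card _ b1)%:R : rat).
move=> G gc gb gc1 gb1 gb1N gc1N gbN gcN GN; move: q => t tN.
have t0 n : t ^+ n != 0 by rewrite expf_neq0.
do !match goal with |- context [t ^+ ?e] => move: (t ^+ e) (t0 e) => ? ? end.
set D := (X in S * X = _); set N := (X in G * X) => e.
have DN : D != 0 by rewrite /D !mulf_neq0.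
have -> : S = G * N / D by rewrite -e mulfK.
rewrite /N /D; field.
by do !(apply/andP; split).
Qed.
End PairSum.
Lemma dv_subE (Q : quiver) (x y : dimvec Q) v : dv_sub x y v = (x v - y v)%N.
Proof. by rewrite ffunE. Qed.

(** * The recursion for signed counts *)

Section Extensionality.
Variables (Q : quiver) (F : finFieldType).
Implicit Types x y n : vertex Q -> nat.

Lemma eq_qeuler x x' y y' : x =1 x' -> y =1 y' -> qeuler F x y = qeuler F x' y'.
Proof. by move=> /functional_extensionality-> /functional_extensionality->. Qed.

Lemma qeuler0l y : qeuler F (fun=> 0%N) y = 1.
Proof.
rewrite /qeuler /vertex_form /arrow_form.
by rewrite !big1 ?divr1 // => ? _; rewrite mul0n.
Qed.

Lemma qgl_card0 : qgl_card F (fun _ : vertex Q => 0%N) = 1%N.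
Proof.
rewrite /qgl_card big1 // => v _; rewrite /gl_card -[RHS](card_mx F 0 0).
by apply: eq_card => X; rewrite !inE thinmx0 -(thinmx0 1%:M) unitmx1.
Qed.

Lemma qr2_00 : qr2 F (fun _ : vertex Q => 0%N) (fun=> 0%N) = 1.
Proof.
rewrite /qr2 qeuler0l /qr1 qgl_card0 /arrow_form big1 => [|a _]; last by rewrite muln0.
by rewrite !expr0 !divr1 ?mulr1 ?invr1.
Qed.

End Extensionality.

Section Recursion.
Variables (Q : quiver) (F : finFieldType) (pos : pred (dimvec Q)).
Implicit Types n c b : vertex Q -> nat.

Lemma triple_sumE K n c b c1 b1 :
  (forall v, n v = c v + b v + (c1 v + b1 v))%N ->
  (\sum_(M : qrep F n)
     \sum_(NL : qmx F n * qmx F n | [&& subrep M NL.1, subrep M NL.2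
        & [forall v, [&& \rank (NL.1 v) == (c v + b v)%N,
            \rank (NL.2 v) == (c v + c1 v)%N
            & \rank (NL.1 v :&: NL.2 v)%MS == c v]]])
     chain_sum pos K M NL.1) / (qgl_card F n)%:R
  = qeuler F c1 b / qeuler F (fun v => c1 v + b1 v)%N (fun v => c v + b v)%N
    * qr2 F b1 c1 * normalized_chain_sum F pos K c b.
Proof.
move/functional_extensionality ->; rewrite -pair_sumE; congr (_ / _).
apply: eq_bigr => M _; apply: eq_bigl => NL.
apply/and3P/and3P => [[sN sL /forallP d] | [/forallP d sN sL]]; split=> //.
  apply/forallP => v; rewrite /pair_config (d v).
  case/andP: sN => /forallP/(_ v)-> _.
  by case/andP: sL => /forallP/(_ v)-> _.
by apply/forallP => v; case/and5P: (d v) => _ _ -> -> ->.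
Qed.

Lemma rank_full_dim n (M : qrep F n) (N : qmx F n) :
  subrep M N -> (forall v, \rank (N v) = n v) -> N = qfull F n.
Proof.
case/andP=> cN _ rN; apply: canonicalP => // [|v].
  by apply/forallP => v; rewrite ffunE genmx1.
rewrite ffunE; apply/eqmxP; rewrite submx1 sub1mx.
by apply/eqP; rewrite rN.
Qed.

Lemma subrep_full n (M : qrep F n) : subrep M (qfull F n).
Proof.
apply/andP; split; first by apply/forallP => v; rewrite ffunE genmx1.
by apply/forallP => a; rewrite !ffunE submx1.
Qed.

(** [triple_sumE] with c1 = b1 = 0: the first member N of the pair is then the
whole of M. *)
Lemma full_chain_sumE K n c b :
  (forall v, n v = c v + b v)%N ->
  (\sum_(M : qrep F n)
     \sum_(L | subrep M L && (sdim L == [ffun v => c v]))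
     chain_sum pos K M (qfull F n)) / (qgl_card F n)%:R
  = normalized_chain_sum F pos K c b.
Proof.
move=> en; have := @triple_sumE K n c b (fun=> 0%N) (fun=> 0%N).
rewrite !qeuler0l qr2_00 divr1 !mul1r => <- => [|v]; last by rewrite !addn0.
congr (_ / _); apply: eq_bigr => M _.
rewrite (reindex_bij _ (h := fun L => (qfull F n, L)) (h' := snd)
   (Q := fun L => subrep M L && (sdim L == [ffun v => c v]))) //.
  move=> [N L] /= /and3P[sN sL /forallP d].
  have -> : N = qfull F n.
    by apply: rank_full_dim sN _ => v; case/and3P: (d v) => /eqP->.
  split=> //; rewrite sL; apply/eqP/ffunP => v; rewrite !ffunE.
  by case/and3P: (d v) => _ /eqP->; rewrite addn0.
move=> L /andP[sL /eqP dL]; split=> //=; rewrite subrep_full sL.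
apply/forallP => v; rewrite !ffunE mxrank1 cap1mx.
by move/ffunP/(_ v): dL; rewrite !ffunE addn0 => ->; rewrite en !eqxx.
Qed.

(** For K = 1 all signed counts are 1, so that here only the representations
preserving a coordinate subspace are counted. *)
Lemma normalized_chain_sum1 c b : normalized_chain_sum F pos 1 c b = qr2 F b c.
Proof.
rewrite /normalized_chain_sum /lower_chain_sum /= prod_lower_gl.
under eq_bigr => A _ do rewrite big1 // subr0.
rewrite sumr_const (card_lower_arrows F c b c b) !natrM !natrX !exprD.
rewrite /qr2 /qr1 /qeuler.
have := q_neq0 F; have := qgl_card_neq0 F c; have := qgl_card_neq0 F b.
move: ((qgl_card _ c)%:R : rat) ((qgl_card _ b)%:R : rat) => gc gb gbN gcN.
move: (#|F|%:R : rat) => t tN.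
have t0 k : t ^+ k != 0 by rewrite expf_neq0.
do !match goal with |- context [t ^+ ?e] => move: (t ^+ e) (t0 e) => ? ? end.
by field; do !(apply/andP; split).
Qed.


Section Split.
Variables alpha gamma : dimvec Q.

(** The possible dimension vectors a of M/N and g of the image of L in M/N, for
L of dimension vector y in M of dimension vector x and N a proper
subrepresentation with [pos (sdim N)]. *)
Definition quotient_dims (x y a g : dimvec Q) : bool :=
  [&& dv_le a x, dv_le g y, dv_le g a, dv_le (dv_sub y g) (dv_sub x a),
      a != 0 & pos (dv_sub x a)].

Definition pair_chain_sum K (x y : dimvec Q) : rat :=
  normalized_chain_sum F pos K y (dv_sub x y).

(** Expand the signed count of M once.  The summand 1 contributes [qr2]; the
subrepresentations N, taken together with L, are grouped by the dimension
vectors of M/N and of the image of L in it, and each group is evaluated by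
[triple_sumE]. *)
Lemma pair_chain_sumS K (x y : dimvec Q) :
  dv_le x alpha -> dv_le y gamma -> dv_le y x ->
  pair_chain_sum K.+1 x y =
  qr2 F (dv_sub x y) y -
  \sum_(p : subdim alpha * subdim gamma | quotient_dims x y (dv_of p.1) (dv_of p.2))
    let a := dv_of p.1 in let g := dv_of p.2 in
    qeuler F g (dv_sub (dv_sub x a) (dv_sub y g)) / qeuler F a (dv_sub x a)
    * qr2 F (dv_sub a g) g * pair_chain_sum K (dv_sub x a) (dv_sub y g).
Proof.
move=> /forallP xa /forallP yg /forallP yx.
have xE v : x v = (y v + dv_sub x y v)%N by rewrite ffunE subnKC.
have dE (L : qmx F x) : (sdim L == [ffun v => y v]) = (sdim L == y).
  by congr (_ == _); apply/ffunP => v; rewrite ffunE.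
rewrite -(normalized_chain_sum1 y (dv_sub x y)) /pair_chain_sum.
rewrite -!(full_chain_sumE _ xE).
set G := (qgl_card F x)%:R; set T := (X in _ = _ - X).
pose proper (M : qrep F x) := [pred NL : qmx F x * qmx F x |
  [&& subrep M NL.1, subrep M NL.2, sdim NL.2 == y, NL.1 != qfull F x
    & pos (sdim NL.1)]].
have -> : T = (\sum_(M : qrep F x) \sum_(NL | proper M NL) chain_sum pos K M NL.1) / G.
  (* dim M/N and dim L/(N :&: L) are bounded by alpha and gamma, so that the
     default value of inord never occurs *)
  pose p (NL : qmx F x * qmx F x) : subdim alpha * subdim gamma :=
    ([ffun v => inord (x v - \rank (NL.1 v))],
     [ffun v => inord (y v - \rank (NL.1 v :&: NL.2 v)%MS)]).
  have p1E NL v : dv_of (p NL).1 v = (x v - \rank (NL.1 v))%N.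
    by rewrite !ffunE inordK // ltnS (leq_trans (leq_subr _ _)).
  have p2E NL v : dv_of (p NL).2 v = (y v - \rank (NL.1 v :&: NL.2 v)%MS)%N.
    by rewrite !ffunE inordK // ltnS (leq_trans (leq_subr _ _)).
  pose good (p : subdim alpha * subdim gamma) :=
    quotient_dims x y (dv_of p.1) (dv_of p.2).
  have pgood M NL : proper M NL -> good (p NL).
    case: NL => N L /and5P[/= sN sL /eqP dL Nfull posN].
    have rN v : (\rank (N v) <= x v)%N by rewrite rank_leq_row.
    have rL v : \rank (L v) = y v by rewrite -dL ffunE.
    have rC v : (\rank (N v :&: L v)%MS <= \rank (N v))%N by rewrite mxrankS ?capmxSl.
    have rC' v : (\rank (N v :&: L v)%MS <= y v)%N by rewrite -rL mxrankS ?capmxSr.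
    have rS v : (\rank (N v) + y v - \rank (N v :&: L v)%MS <= x v)%N.
      by rewrite -rL -mxrank_sum_cap addnK rank_leq_row.
    have aux1 r k X Y : (r + Y - k <= X -> k <= r -> r <= X -> Y - k <= X - r)%N by lia.
    have e1 v := p1E (N, L) v; have e2 v := p2E (N, L) v; rewrite /= in e1 e2.
    rewrite /good /quotient_dims; do !(apply/andP; split).
    - by apply/forallP => v; rewrite e1; lia.
    - by apply/forallP => v; rewrite e2; lia.
    - by apply/forallP => v; rewrite e1 e2; apply: aux1.
    - apply/forallP => v; rewrite !dv_subE e1 e2.
      by rewrite subKn // subKn.
    - apply: contra Nfull => /eqP z; apply/eqP; apply: (rank_full_dim sN) => v.
      by apply/eqP; rewrite eqn_leq rN -subn_eq0 -e1 z ffunE.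
    - have -> // : dv_sub x (dv_of (p (N, L)).1) = sdim N.
      by apply/ffunP => v; rewrite dv_subE e1 [RHS]ffunE subKn.
  rewrite /T -/good; under [in RHS]eq_bigr => M _ do
    rewrite (partition_big p good (pgood M)).
  rewrite exchange_big mulr_suml; apply: eq_bigr => q gq.
  have /and5P[/forallP qax /forallP qgy /forallP qga /forallP qs qpos] := gq.
  set a := dv_of q.1 in qax qga qs qpos *; set g := dv_of q.2 in qgy qga qs *.
  pose c := dv_sub y g; pose b := dv_sub (dv_sub x a) c; pose b1 := dv_sub a g.
  have cbE v : (c v + b v = dv_sub x a v)%N by rewrite [b v]dv_subE subnKC.
  have cgE v : (g v + b1 v = a v)%N by rewrite [b1 v]dv_subE subnKC.
  have yE v : (c v + g v = y v)%N by rewrite [c v]dv_subE subnK.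
  have xE' v : x v = (c v + b v + (g v + b1 v))%N.
    by rewrite cbE cgE dv_subE subnK.
  transitivity (qeuler F g b / qeuler F (fun v => g v + b1 v)%N (fun v => c v + b v)%N
    * qr2 F b1 g * normalized_chain_sum F pos K c b).
    by congr (_ / _ * _ * _); apply: eq_qeuler => v.
  rewrite -(triple_sumE K xE'); congr (_ / _); apply: eq_bigr => M _.
  apply: eq_bigl => [[N L]] /=; apply/and3P/andP => [[sN sL /forallP d] | ].
    have rN v : \rank (N v) = dv_sub x a v by case/and3P: (d v) => /eqP->.
    split.
      apply/and5P; split=> //=.
      - by apply/eqP/ffunP => v; rewrite ffunE; case/and3P: (d v) => _ /eqP-> _.
      - case/andP: qpos => a0 _; apply: contra a0 => /eqP Nf.
        apply/eqP/ffunP => v; rewrite [RHS]ffunE.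
        have := rN v; rewrite Nf [qfull _ _ _]ffunE mxrank1 dv_subE.
        have sub0 X A : (X = X - A -> A <= X -> A = 0)%N by lia.
        by move/sub0; apply; apply: qax.
      - case/andP: qpos => _ ; congr (is_true (pos _)).
        by apply/ffunP => v; rewrite [RHS]ffunE.
    apply/eqP/injective_projections; apply/ffunP => v; apply/val_inj.
      have := p1E (N, L) v; rewrite ffunE => e; apply: etrans e _.
      by rewrite /= rN dv_subE subKn // ffunE.
    have := p2E (N, L) v; rewrite ffunE => e; apply: etrans e _.
    by case/and3P: (d v) => _ _ /eqP /= ->; rewrite dv_subE subKn // ffunE.
  case=> /and5P[/= sN sL /eqP dL Nf Npos] /eqP pq; split=> //; apply/forallP => v.
  have e1 := p1E (N, L) v; have e2 := p2E (N, L) v; rewrite pq /= in e1 e2.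
  have yr : y v = \rank (L v) by rewrite -dL ffunE.
  rewrite cbE yE [in X in [&& _, X & _]]yr eqxx /= dv_subE [c v]dv_subE /a /g e1 e2.
  rewrite !subKn ?eqxx ?rank_leq_row //.
  by rewrite yr mxrankS ?capmxSr.
apply: (canRL (addrK _)); rewrite -mulrDl; congr (_ / _).
rewrite -big_split; apply: eq_bigr => M _ /=.
have -> : \sum_(NL | proper M NL) chain_sum pos K M NL.1 =
  \sum_(L | subrep M L && (sdim L == [ffun v => y v]))
    \sum_(N | [&& subrep M N, qle N (qfull F x), N != qfull F x & pos (sdim N)])
      chain_sum pos K M N.
  rewrite exchange_big pair_big; apply: eq_bigl => [[N L]] /=.
  have -> : qle N (qfull F x) by apply/forallP => v; rewrite ffunE submx1.
  rewrite dE; case: (subrep M N) => //=; case: (subrep M L); rewrite ?andbF //=.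
  by rewrite andbC.
rewrite -big_split; apply: eq_bigr => L _ /=.
by rewrite subrK big1 // subr0.
Qed.
End Split.
End Recursion.

(** * Splitting off the first part of a decomposition *)

Section FirstEntry.
Variable T : finType.

Definition fcons s (t : T) (d : {ffun 'I_s -> T}) : {ffun 'I_s.+1 -> T} :=
  [ffun i => oapp d t (unlift ord0 i)].

Lemma fcons0 s t (d : {ffun 'I_s -> T}) : fcons t d ord0 = t.
Proof. by rewrite ffunE unlift_none. Qed.

Lemma fconsS s t (d : {ffun 'I_s -> T}) i : fcons t d (lift ord0 i) = d i.
Proof. by rewrite ffunE liftK. Qed.

Lemma big_fcons s (P : pred {ffun 'I_s.+1 -> T}) (E : {ffun 'I_s.+1 -> T} -> rat) :
  \sum_(d | P d) E d = \sum_t \sum_(d | P (fcons t d)) E (fcons t d).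
Proof.
rewrite pair_big_dep /=.
apply: (reindex_bij _ (h := fun p => fcons p.1 p.2)
   (h' := fun d => (d ord0, [ffun i => d (lift ord0 i)]))) => [d Pd | [t d] Pd] /=.
  have dE : fcons (d ord0) [ffun i => d (lift ord0 i)] = d.
    apply/ffunP => i; case: (unliftP ord0 i) => [j|] ->; last by rewrite fcons0.
    by rewrite fconsS ffunE.
  by rewrite dE.
by split=> //; congr (_, _); [rewrite fcons0 | apply/ffunP => i; rewrite ffunE fconsS].
Qed.

Lemma eq_ffun0 (d1 d2 : {ffun 'I_0 -> T}) : d1 = d2.
Proof. by apply/ffunP => [[]]. Qed.
End FirstEntry.

Section DimensionVectorArithmetic.
Variable Q : quiver.
Implicit Types x y a g : dimvec Q.

Lemma dv_addE x y v : (x + y) v = (x v + y v)%N.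
Proof. by rewrite ffunE. Qed.

Lemma dv_sumE (I : finType) (P : pred I) (x : I -> dimvec Q) v :
  (\sum_(i | P i) x i) v = (\sum_(i | P i) x i v)%N.
Proof. by rewrite sum_ffunE. Qed.

Lemma dv_add_eq a z x : (a + z == x) = dv_le a x && (z == dv_sub x a).
Proof.
apply/eqP/andP => [<- | [/forallP le /eqP ->]].
  split; first by apply/forallP => v; rewrite dv_addE leq_addr.
  by apply/eqP/ffunP => v; rewrite dv_subE dv_addE addKn.
by apply/ffunP => v; rewrite dv_addE dv_subE subnKC.
Qed.

Lemma dv_sub_sum (I : finType) (a g : I -> dimvec Q) :
  (forall i, dv_le (g i) (a i)) ->
  \sum_i dv_sub (a i) (g i) = dv_sub (\sum_i a i) (\sum_i g i).
Proof.
move=> le; apply/ffunP => v; rewrite dv_subE !dv_sumE -sumnB => [|i _].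
  by apply: eq_bigr => i _; rewrite dv_subE.
by have /forallP := le i.
Qed.

Lemma qeuler_sumr (F : finFieldType) x (I : finType) (y : I -> dimvec Q) :
  qeuler F x (\sum_i y i : dimvec Q) = \prod_i qeuler F x (y i).
Proof.
apply: (big_morph (fun z : dimvec Q => qeuler F x z)) => [y1 y2|].
  by rewrite -qeulerDr; apply: eq_qeuler => // v; rewrite dv_addE.
rewrite /qeuler /vertex_form /arrow_form !big1 ?divr1 // => ? _;
  by rewrite ffunE muln0.
Qed.
End DimensionVectorArithmetic.

Section FlagSum.
Variables (Q : quiver) (F : finFieldType) (pos : pred (dimvec Q)).
Variables alpha gamma : dimvec Q.

Let D : finType := (subdim alpha * subdim gamma)%type.
Implicit Types (x y : dimvec Q) (p : D).
Definition part_dim p : dimvec Q := dv_of p.1.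
Definition part_sub p : dimvec Q := dv_of p.2.
Definition part_quo p : dimvec Q := dv_sub (part_dim p) (part_sub p).

(** The partial sums of the first k parts are required to have slope below
mu(alpha); here this is expressed by the complementary sums, which are the
dimension vectors of the members of the chain and behave well when the first
part is split off. *)
Definition flag_type s x y (e : {ffun 'I_s -> D}) : bool :=
  [&& \sum_i part_dim (e i) == x, \sum_i part_sub (e i) == y,
      [forall i, (part_dim (e i) != 0) && dv_le (part_sub (e i)) (part_dim (e i))] &
      [forall k : 'I_s, (0 < k)%N ==> pos (\sum_(l < s | (k <= l)%N) part_dim (e l))]].

Definition flag_term s (e : {ffun 'I_s -> D}) : rat :=
  (\prod_(i < s) \prod_(j < s | (i < j)%N)
     (qeuler F (part_sub (e i)) (part_quo (e j))
      / qeuler F (part_dim (e i)) (part_dim (e j))))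
  * \prod_(k < s) qr2 F (part_quo (e k)) (part_sub (e k)).

Definition flag_sum s x y : rat :=
  \sum_(e : {ffun 'I_s -> D} | flag_type x y e) flag_term e.

Lemma flag_type1 x y p (e : {ffun 'I_0 -> D}) :
  flag_type x y (fcons p e) =
  [&& part_dim p == x, part_sub p == y, part_dim p != 0
    & dv_le (part_sub p) (part_dim p)].
Proof.
rewrite /flag_type !big_ord_recl !big_ord0 !addr0 !fcons0.
congr [&& _, _ & _]; apply/andP/idP => [[/forallP/(_ ord0)] | P].
  by rewrite fcons0.
by split; apply/forallP => i; rewrite (ord1 i) ?fcons0.
Qed.

Lemma sum_fcons s (f : D -> dimvec Q) p (e : {ffun 'I_s -> D}) :
  \sum_i f (fcons p e i) = f p + \sum_i f (e i).
Proof.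
by rewrite big_ord_recl fcons0; under eq_bigr => i _ do rewrite fconsS.
Qed.

Lemma forall_fcons s (P : pred D) p (e : {ffun 'I_s -> D}) :
  [forall i, P (fcons p e i)] = P p && [forall i, P (e i)].
Proof.
apply/forallP/andP => [Pe | [Pp /forallP Pe] i].
  split; first by have := Pe ord0; rewrite fcons0.
  by apply/forallP => i; have := Pe (lift ord0 i); rewrite fconsS.
by case: (unliftP ord0 i) => [j|] ->; rewrite ?fcons0 ?fconsS.
Qed.

Lemma tail_sum_fcons s (f : D -> dimvec Q) p (e : {ffun 'I_s -> D}) (k : 'I_s) :
  \sum_(l < s.+1 | (lift ord0 k <= l)%N) f (fcons p e l)
  = \sum_(l < s | (k <= l)%N) f (e l).
Proof.
rewrite big_mkcond big_ord_recl /= add0r [RHS]big_mkcond.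
by apply: eq_bigr => l _; rewrite fconsS leq_bump2.
Qed.

(** The tail sum at index 1 is dim N = x - a: this is where the condition [pos]
of [quotient_dims] comes from. *)
Lemma flag_typeS s x y p (e : {ffun 'I_s.+1 -> D}) :
  flag_type x y (fcons p e) =
  quotient_dims pos x y (part_dim p) (part_sub p)
  && flag_type (dv_sub x (part_dim p)) (dv_sub y (part_sub p)) e.
Proof.
rewrite /flag_type /quotient_dims !sum_fcons !dv_add_eq.
rewrite (forall_fcons (fun q => (part_dim q != 0) && dv_le (part_sub q) (part_dim q))).
have -> : [forall k : 'I_s.+2, (0 < k)%N ==>
             pos (\sum_(l < s.+2 | (k <= l)%N) part_dim (fcons p e l))]
  = pos (\sum_i part_dim (e i)) && [forall k : 'I_s.+1, (0 < k)%N ==>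
             pos (\sum_(l < s.+1 | (k <= l)%N) part_dim (e l))].
  apply/forallP/andP => [tl | [tl0 /forallP tl] k].
    split; first by have := tl (lift ord0 ord0); rewrite tail_sum_fcons lift0 /=.
    apply/forallP => k; have := tl (lift ord0 k); rewrite tail_sum_fcons lift0 /= => ->.
    exact: implybT.
  case: (unliftP ord0 k) => [j|] -> //; rewrite tail_sum_fcons lift0 /=.
  have [j0 | j0] := posnP j; last by have /implyP := tl j; apply.
  by rewrite j0.
case: eqP => [A | _]; last by rewrite !andbF.
case: eqP => [G | _]; last by rewrite !andbF.
case: forallP => [le | _]; last by rewrite !andbF.
have -> : dv_le (dv_sub y (part_sub p)) (dv_sub x (part_dim p)).
  rewrite -A -G; apply/forallP => v; rewrite !dv_sumE.
  by apply: leq_sum => i _; case/andP: (le i) => _ /forallP.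
rewrite A !andbT /=.
by case: (dv_le _ _); case: (dv_le _ _); case: (dv_le _ _); case: (_ != _);
  rewrite ?andbF.
Qed.

Lemma flag_termS s x y p (e : {ffun 'I_s -> D}) :
  flag_type x y e ->
  flag_term (fcons p e) =
  qeuler F (part_sub p) (dv_sub x y) / qeuler F (part_dim p) x
  * qr2 F (part_quo p) (part_sub p)
  * flag_term e.
Proof.
case/and4P => /eqP <- /eqP <- /forallP le _.
rewrite -dv_sub_sum => [|i]; last by case/andP: (le i).
rewrite !qeuler_sumr -prodf_div /flag_term !big_ord_recl !fcons0.
have row0 (f : D -> rat) :
    \prod_(j < s.+1 | (@ord0 s < j)%N) f (fcons p e j) = \prod_j f (e j).
  rewrite big_mkcond big_ord_recl /= mul1r; apply: eq_bigr => j _.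
  by rewrite fconsS.
have rowS (f : D -> rat) (i : 'I_s) :
    \prod_(j < s.+1 | (lift ord0 i < j)%N) f (fcons p e j)
    = \prod_(j < s | (i < j)%N) f (e j).
  rewrite big_mkcond big_ord_recl /= mul1r [RHS]big_mkcond; apply: eq_bigr => j _.
  by rewrite fconsS ltnNge leq_bump2 -ltnNge.
rewrite (row0 (fun q => qeuler F (part_sub p) (part_quo q)
                        / qeuler F (part_dim p) (part_dim q))).
under [X in _ * X * _ = _]eq_bigr => i _ do
  rewrite fconsS (rowS (fun q => qeuler F (part_sub (e i)) (part_quo q)
                                / qeuler F (part_dim (e i)) (part_dim q))).
under [X in _ * (_ * X) = _]eq_bigr => i _ do rewrite fconsS.
by rewrite mulrACA.
Qed.

Lemma flag_sum1 x y :
  x != 0 -> dv_le x alpha -> dv_le y gamma -> dv_le y x ->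
  flag_sum 1 x y = qr2 F (dv_sub x y) y.
Proof.
move=> x0 /forallP xa /forallP yg yx.
pose p : D := ([ffun v => inord (x v)], [ffun v => inord (y v)]).
have pa : part_dim p = x by apply/ffunP => v; rewrite !ffunE inordK // ltnS.
have pg : part_sub p = y by apply/ffunP => v; rewrite !ffunE inordK // ltnS.
have pP q (e : {ffun 'I_0 -> D}) : flag_type x y (fcons q e) = (q == p).
  rewrite flag_type1; apply/and4P/eqP => [[/eqP qa /eqP qg _ _] | ->].
    apply/injective_projections; apply/ffunP => v; apply/val_inj.
      by have /ffunP/(_ v) := etrans qa (esym pa); rewrite !ffunE.
    by have /ffunP/(_ v) := etrans qg (esym pg); rewrite !ffunE.
  by rewrite pa pg !eqxx.
rewrite /flag_sum big_fcons (bigD1 p) //= [X in _ + X]big1 => [|q /negPf qp].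
  under eq_bigl => e do rewrite pP eqxx.
  rewrite addr0 (big_pred1 [ffun=> p]) => [|e]; last first.
    by apply/esym/eqP; apply: eq_ffun0.
  rewrite /flag_term !big_ord1 big_pred0 => [|j]; last by rewrite (ord1 j).
  by rewrite mul1r fcons0 /part_quo pa pg.
by rewrite big1 // => e; rewrite pP qp.
Qed.

Lemma flag_sumS s x y :
  flag_sum s.+2 x y =
  \sum_(p | quotient_dims pos x y (part_dim p) (part_sub p))
    qeuler F (part_sub p) (dv_sub (dv_sub x (part_dim p)) (dv_sub y (part_sub p)))
    / qeuler F (part_dim p) (dv_sub x (part_dim p)) * qr2 F (part_quo p) (part_sub p)
    * flag_sum s.+1 (dv_sub x (part_dim p)) (dv_sub y (part_sub p)).
Proof.
rewrite /flag_sum big_fcons [RHS]big_mkcond; apply: eq_bigr => p _.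
under eq_bigl => e do rewrite flag_typeS.
case: (quotient_dims _ _ _ _ _) => /=; last by rewrite big_pred0_eq.
by rewrite mulr_sumr; apply: eq_bigr => e /flag_termS ->.
Qed.

Hypothesis pos0 : ~~ pos 0.

(** Both sides obey the same recursion and vanish for K = 0.  The hypothesis
[pos0] keeps the recursion away from x = 0, where the empty decomposition would
intervene. *)
Lemma pair_chain_sum_flags K x y :
  x != 0 -> dv_le x alpha -> dv_le y gamma -> dv_le y x ->
  pair_chain_sum F pos K x y = \sum_(s < K) (-1) ^+ s * flag_sum s.+1 x y.
Proof.
elim: K x y => [|K IH] x y x0 xa yg yx.
  rewrite big_ord0 /pair_chain_sum /normalized_chain_sum /lower_chain_sum /=.
  by rewrite big1_eq mul0r.
rewrite (@pair_chain_sumS _ _ _ alpha gamma) //.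
rewrite big_ord_recl expr0 mul1r flag_sum1 //; congr (_ + _).
under [RHS]eq_bigr => s _ do rewrite flag_sumS mulr_sumr.
rewrite [RHS]exchange_big -sumrN; apply: eq_bigr => p gp /=.
have /and5P[pa pg _ le /andP[_ pp]] := gp.
rewrite IH //; first last.
- by apply/forallP => v; rewrite dv_subE (leq_trans (leq_subr _ _)) // (forallP yg).
- by apply/forallP => v; rewrite dv_subE (leq_trans (leq_subr _ _)) // (forallP xa).
- by apply: contra pos0 => /eqP <-.
rewrite -mulrN -sumrN !mulr_sumr; apply: eq_bigr => s _.
by rewrite exprS mulN1r !mulNr mulrN mulrCA.
Qed.

End FlagSum.

(** * Semistability as a signed count of destabilizing chains *)

Section Destabilizing.
Variables (Q : quiver) (F : finFieldType).
Variable f : dimvec Q -> int.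
Hypothesis fD : forall x y, f (x + y) = f x + f y.

Let pos : pred (dimvec Q) := fun x => 0 < f x.

Variables (n : vertex Q -> nat) (M : qrep F n).
Implicit Types X Y N D : qmx F n.

Definition qcap X Y : qmx F n := [ffun v => <<X v :&: Y v>>%MS].
Definition qadd X Y : qmx F n := [ffun v => <<(X v + Y v)%MS>>%MS].
Definition qrank X : nat := (\sum_v \rank (X v))%N.

Lemma subrep_cap X Y : subrep M X -> subrep M Y -> subrep M (qcap X Y).
Proof.
move=> /andP[_ /forallP sX] /andP[_ /forallP sY].
rewrite /subrep canonical_gen; apply/forallP => a; rewrite !ffunE.
rewrite genmxE (eqmxMr _ (genmxE _)) sub_capmx.
by rewrite (submx_trans (submxMr _ (capmxSl _ _)) (sX a))
           (submx_trans (submxMr _ (capmxSr _ _)) (sY a)).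
Qed.

Lemma subrep_add X Y : subrep M X -> subrep M Y -> subrep M (qadd X Y).
Proof.
move=> /andP[_ /forallP sX] /andP[_ /forallP sY].
rewrite /subrep canonical_gen; apply/forallP => a; rewrite !ffunE.
rewrite genmxE (eqmxMr _ (genmxE _)). rewrite addsmxMr addsmx_sub.
by rewrite (submx_trans (sX a) (addsmxSl _ _)) (submx_trans (sY a) (addsmxSr _ _)).
Qed.

Lemma sdim_cap_add X Y : sdim (qadd X Y) + sdim (qcap X Y) = sdim X + sdim Y.
Proof.
by apply/ffunP => v; rewrite !dv_addE !ffunE !genmxE mxrank_sum_cap.
Qed.

Lemma qle_cap N X Y : qle N (qcap X Y) = qle N X && qle N Y.
Proof.
apply/forallP/andP => [le | [/forallP lX /forallP lY] v].
  by split; apply/forallP => v; have := le v;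
    rewrite ffunE genmxE sub_capmx => /andP[].
by rewrite ffunE genmxE sub_capmx lX lY.
Qed.

Lemma qle_refl X : qle X X.
Proof. by apply/forallP. Qed.

Lemma qrank_lt N X :
  canonical N -> canonical X -> qle N X -> N != X -> (qrank N < qrank X)%N.
Proof.
move=> cN cX NX; apply: contraNltn => le; apply/eqP.
apply: qle_anti => //; apply/forallP => v; move/forallP: (NX) => NXv.
rewrite -(mxrank_leqif_sup (NXv v)) eqn_leq mxrankS //=.
rewrite leqNgt; apply: contraTN le => lt; rewrite -ltnNge.
rewrite /qrank (bigD1 v) //= [X in (_ < X)%N](bigD1 v) //=.
by rewrite -addSn leq_add // leq_sum // => w _; rewrite mxrankS.
Qed.

Lemma f0 : f 0 = 0.
Proof. by apply: (addrI (f 0)); rewrite -fD !addr0. Qed.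

Lemma sdim0_rank X : (qrank X == 0%N) = (sdim X == 0).
Proof.
rewrite /qrank sum_nat_eq0; apply/forallP/eqP => [z | /ffunP z v].
  by apply/ffunP => v; rewrite !ffunE; apply/eqP/(implyP (z v)).
by have := z v; rewrite !ffunE => ->.
Qed.

(** The ranks strictly decrease along a chain, so a chain below X has fewer than
K members. *)
Lemma chain_sum_stable K X :
  canonical X -> sdim X != 0 -> (qrank X <= K)%N ->
  chain_sum pos K.+1 M X = chain_sum pos K M X.
Proof.
elim: K X => [|K IH] X cX; first by rewrite leqn0 -sdim0_rank => /negPf->.
move=> X0 rX; rewrite [LHS]/= [RHS]/=; congr (_ - _).
apply: eq_bigr => N /and4P[sN NX NneX posN]; have /andP[cN _] := sN.
apply: IH => //; last by rewrite -ltnS (leq_trans (qrank_lt cN cX NX NneX)).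
by apply: contraTneq posN => ->; rewrite /pos f0 ltxx.
Qed.

Section Maximal.
Variable D : qmx F n.
Hypotheses (sD : subrep M D) (posD : pos (sdim D)).
Hypothesis maxD : forall N, subrep M N -> f (sdim N) <= f (sdim D).

(** The contraction N >= N :&: D <= D in terms of signed counts.  By induction
only the N contained in D contribute to the expansion of the count at X; these
are the destabilizing N <= Y with Y = X :&: D.  As Y is itself destabilizing,
N = Y contributes the count at Y, and the N < Y contribute 1 minus the count
at Y, which together cancel the leading 1. *)
Lemma chain_sum_not_below K X :
  subrep M X -> pos (sdim X) || (X == qfull F n) -> ~~ qle X D ->
  (qrank X <= K)%N -> chain_sum pos K M X = 0.
Proof.
elim: K X => // K IH X sX posX XD rX /=.
have /andP[cX _] := sX; have /andP[cD _] := sD.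
pose Y := qcap X D.
have sY : subrep M Y by apply: subrep_cap.
have cY : canonical Y by case/andP: sY.
have posY : pos (sdim Y).
  case/orP: posX => [posX | /eqP XF]; last first.
    suff -> : Y = D by [].
    apply: canonicalP => // v; rewrite [Y v]ffunE XF [qfull _ _ _]ffunE cap1mx.
    exact: genmxE.
  (* f(X) + f(D) = f(X + D) + f(Y) and f(X + D) <= f(D) give f(Y) >= f(X) *)
  have := maxD (subrep_add sX sD).
  have : f (sdim (qadd X D)) + f (sdim Y) = f (sdim X) + f (sdim D).
    by rewrite -!fD sdim_cap_add.
  by move: posX; rewrite /pos; lia.
have YX : qle Y X by have := qle_refl Y; rewrite qle_cap => /andP[].
have YneX : Y != X.
  apply: contraNneq XD => <-.
  by have := qle_refl Y; rewrite qle_cap => /andP[].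
have rY : (qrank Y <= K)%N by rewrite -ltnS (leq_trans (qrank_lt cY cX YX YneX)).
have Y0 : sdim Y != 0.
  by apply: contraTneq posY => ->; rewrite /pos f0 ltxx.
have stY := chain_sum_stable cY Y0 rY.
rewrite (bigID (fun N => qle N D)) /= [X in _ - (_ + X)]big1 ?addr0 => [|N]; last first.
  case/andP=> /and4P[sN NX NneX posN] ND; have /andP[cN _] := sN.
  apply: IH => //; first by rewrite posN.
  by rewrite -ltnS (leq_trans (qrank_lt cN cX NX NneX)).
rewrite (bigD1 Y) /=; last first.
  by rewrite sY YX YneX posY /=; have := qle_refl Y; rewrite qle_cap => /andP[].
rewrite -stY /= [X in _ - (_ + X)](_ : _ =
  \sum_(N | [&& subrep M N, qle N Y, N != Y & pos (sdim N)])
    chain_sum pos K M N) ?subrK ?subrr //.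
apply: eq_bigl => N; rewrite qle_cap.
have [-> | NneY] := eqVneq N Y; first by rewrite !andbF.
have [ND|] := boolP (qle N D); last by rewrite !andbF.
have [eNX|_] := eqVneq N X; last by rewrite !andbT.
by rewrite eNX (negPf XD) in ND.
Qed.

End Maximal.

Lemma chain_sum_full K :
  f (sdim (qfull F n)) = 0 -> (0 < K)%N -> (qrank (qfull F n) <= K)%N ->
  chain_sum pos K M (qfull F n) = [forall L, subrep M L ==> (f (sdim L) <= 0)]%:R.
Proof.
move=> full0 K0 rK.
have [/forallP ss | /forallPn[D0]] := boolP
  [forall L, subrep M L ==> (f (sdim L) <= 0)].
  case: K K0 {rK} => //= K _; rewrite big1 ?subr0 // => N /and4P[sN _ _].
  by rewrite /pos ltNge (implyP (ss N) sN).
rewrite negb_imply -ltNge => /andP[sD0 posD0].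
have [D sD maxD] :=
  @Order.TotalTheory.arg_maxP _ _ _ D0 (subrep M) (fun N => f (sdim N)) sD0.
have posD : pos (sdim D) by apply: lt_le_trans posD0 (maxD _ sD0).
apply: (chain_sum_not_below sD posD maxD) => //.
- exact: subrep_full.
- by rewrite eqxx orbT.
apply: contraTN posD => fD'; rewrite /pos.
suff -> : D = qfull F n by rewrite full0 ltxx.
have /andP[cD _] := sD; have /andP[cF _] := subrep_full M.
by apply: qle_anti => //; apply/forallP => v; rewrite ffunE submx1.
Qed.

End Destabilizing.

(** * Isomorphism classes *)

Section IsomorphismClasses.
Variables (Q : quiver) (F : finFieldType) (alpha : dimvec Q).
Implicit Types M N : rep F alpha.

Definition conj_rep M (g : vmx F alpha) : rep F alpha :=
  [ffun a => invmx (g (tail a)) *m M a *m g (Defs.head a)].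

Definition gmul (g h : vmx F alpha) : vmx F alpha := [ffun v => g v *m h v].
Definition ginv (g : vmx F alpha) : vmx F alpha := [ffun v => invmx (g v)].

Lemma is_hom_conj M N g : g \in GLv F alpha -> is_hom M N g = (conj_rep M g == N).
Proof.
rewrite inE => /forallP gu; apply/forallP/eqP => [h | <- a].
  by apply/ffunP => a; rewrite ffunE -mulmxA (eqP (h a)) mulKmx ?gu.
by rewrite ffunE -mulmxA mulKVmx ?gu.
Qed.

Lemma is_hom_comp M N P g h :
  is_hom M N g -> is_hom N P h -> is_hom M P (gmul g h).
Proof.
move=> /forallP gh /forallP hh; apply/forallP => a; rewrite !ffunE.
by rewrite mulmxA (eqP (gh a)) -!mulmxA (eqP (hh a)).
Qed.

Lemma is_hom_inv M N g :
  g \in GLv F alpha -> is_hom M N g -> is_hom N M (ginv g).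
Proof.
rewrite inE => /forallP gu /forallP gh; apply/forallP => a; rewrite !ffunE.
by rewrite -[N a](mulKmx (gu (tail a))) -(eqP (gh a)) !mulmxA mulmxK ?gu.
Qed.

Lemma GLv_mul g h :
  g \in GLv F alpha -> h \in GLv F alpha -> gmul g h \in GLv F alpha.
Proof.
rewrite inE => /forallP gu; rewrite inE => /forallP hu; rewrite inE; apply/forallP => v.
by rewrite ffunE unitmx_mul gu hu.
Qed.

Lemma GLv_inv g : g \in GLv F alpha -> ginv g \in GLv F alpha.
Proof.
rewrite inE => /forallP gu; rewrite inE; apply/forallP => v.
by rewrite ffunE unitmx_inv gu.
Qed.

(** Orbit and stabilizer: the isomorphisms from M to a given N in its class form
a coset of the automorphism group of M. *)
Lemma card_iso_class M :
  (#|[pred N | rep_iso M N]| * aut_card M)%N = #|GLv F alpha|.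
Proof.
rewrite -[RHS]sum1_card (partition_big (conj_rep M) (rep_iso M)) /=; last first.
  move=> g gG.
  by apply/existsP; exists g; rewrite gG is_hom_conj // eqxx.
rewrite -sum_nat_const; apply: eq_bigr => N /existsP[g0 /andP[g0G g0h]].
rewrite sum1_card /aut_card.
have g0u v : g0 v \in unitmx by move: g0G; rewrite inE => /forallP/(_ v).
apply: (card_bij (h := fun g => gmul g (ginv g0))
                 (h' := fun g => gmul g g0)).
  move=> g gA; split.
    have /setIdP[gG gh] : g \in [set g in GLv F alpha | is_hom M M g] := gA.
    by rewrite -is_hom_conj ?GLv_mul //; apply: is_hom_comp gh g0h.
  by apply/ffunP => v; rewrite !ffunE mulmxK ?g0u.
move=> g /andP[gG]; rewrite -is_hom_conj // => gh; split.
  suff : gmul g (ginv g0) \in [set g in GLv F alpha | is_hom M M g] by [].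
  apply/setIdP; rewrite GLv_mul ?GLv_inv //; split=> //; apply: is_hom_comp gh _.
  exact: is_hom_inv.
by apply/ffunP => v; rewrite !ffunE mulmxKV ?g0u.
Qed.

Lemma aut_card_neq0 M : (aut_card M)%:R != 0 :> rat.
Proof.
rewrite pnatr_eq0; apply: contraTneq (qgl_card_neq0 F alpha) => a0.
rewrite -card_qunit; have := card_iso_class M; rewrite a0 muln0 => G0.
rewrite negbK pnatr_eq0 G0; apply/eqP/esym/eq_card => g; by rewrite inE.
Qed.

Lemma sum_iso_reps (psi : rep F alpha -> rat) :
  (forall M N, rep_iso M N -> psi M = psi N) ->
  \sum_(M in iso_reps F alpha) psi M / (aut_card M)%:R
  = (\sum_M psi M) / #|GLv F alpha|%:R.
Proof.
move=> psiE; pose P := equivalence_partition (@rep_iso Q F alpha) setT.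
have eqv : {in [set: rep F alpha] & &, equivalence_rel (@rep_iso Q F alpha)}.
  by move=> M N N' _ _ _; apply: rep_iso_equiv.
have partP : partition P setT := equivalence_partitionP eqv.
have trX := transversalP partP; have /and3P[_ tiP _] := partP.
have sumE : \sum_M psi M = \sum_(A in P) \sum_(M in A) psi M.
  by rewrite -(set_partition_big _ partP) /=; apply: eq_bigl => M; rewrite inE.
rewrite sumE -{1}(pblock_transversal trX) [X in _ = X / _]big_imset /=;
  last exact: pblock_inj trX.
rewrite mulr_suml; apply: eq_bigr => M _.
have -> : \sum_(N in pblock P M) psi N = #|[pred N | rep_iso M N]|%:R * psi M.
  rewrite mulr_natl -sumr_const; apply: eq_big => N; first last.
    by rewrite (pblock_equivalence_partition eqv) ?inE // => /psiE.
  by rewrite (pblock_equivalence_partition eqv) ?inE.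
have := aut_card_neq0 M; have := qgl_card_neq0 F alpha.
rewrite -card_qunit (_ : #|_| = #|GLv F alpha|); last first.
  by apply: eq_card => g; rewrite !inE.
rewrite -(card_iso_class M) natrM.
move=> CA A; rewrite -mulf_div divff ?mul1r //.
by apply: contraNneq CA => ->; rewrite mul0r.
Qed.

End IsomorphismClasses.

(** * Slopes and weighted quiver Grassmannians *)

Section Slope.
Variables (Q : quiver) (mu : slope Q) (alpha : dimvec Q).
Hypothesis alpha0 : alpha != 0.

(** The function f whose sign measures destabilization: mu(x) - mu(alpha) cleared
of its positive denominators, hence additive. *)
Definition slope_excess (x : dimvec Q) : int :=
  slope_num mu (dv_int x) * slope_den mu (dv_int alpha)
  - slope_num mu (dv_int alpha) * slope_den mu (dv_int x).

Lemma slope_excessD x y : slope_excess (x + y) = slope_excess x + slope_excess y.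
Proof.
have e : dv_int (x + y) = dv_int x + dv_int y.
  by apply/ffunP => v; rewrite !ffunE PoszD.
by rewrite /slope_excess e !raddfD /=; ring.
Qed.

Lemma slope_excess_self : slope_excess alpha = 0.
Proof. exact: subrr. Qed.

Lemma slope_val_lt x : x != 0 -> (mu x < mu alpha) = (slope_excess x < 0).
Proof.
move=> x0; have tx := slope_den_gt0 mu x0; have ta := slope_den_gt0 mu alpha0.
rewrite /slope_val ltr_pdivrMr ?ltr0z // mulrAC ltr_pdivlMr ?ltr0z //.
by rewrite -!intrM ltr_int -subr_lt0.
Qed.

Lemma slope_val_le x : x != 0 -> (mu x <= mu alpha) = (slope_excess x <= 0).
Proof.
move=> x0; have tx := slope_den_gt0 mu x0; have ta := slope_den_gt0 mu alpha0.
rewrite /slope_val ler_pdivrMr ?ltr0z // mulrAC ler_pdivlMr ?ltr0z //.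
by rewrite -!intrM ler_int -subr_le0.
Qed.

Lemma slope_excess0 : slope_excess 0 = 0.
Proof. exact: f0 slope_excessD. Qed.

Lemma semistableE (F : finFieldType) (M : rep F alpha) :
  semistable mu M =
  [forall L : qmx F alpha,
     subrep (M : qrep F alpha) L ==> (slope_excess (sdim L) <= 0)].
Proof.
apply: eq_forallb => L.
rewrite -[is_subrep M L]/(subrep (M : qrep F alpha) L) -[subrep_dim L]/(sdim L).
case: (subrep _ L) => //=; have [-> | L0] := eqVneq (sdim L) 0.
  by rewrite slope_excess0 lexx.
by rewrite /= slope_val_le.
Qed.

End Slope.

Section Comparison.
Variables (Q : quiver) (F : finFieldType).
Implicit Types x y : dimvec Q.

Lemma eulerE x y : euler F x y = qeuler F x y.
Proof.
rewrite /euler /euler_a.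
have -> : \sum_v (x v)%:Z * (y v)%:Z = (vertex_form x y)%:Z.
  by rewrite /vertex_form (big_morph Posz PoszD (erefl _)).
have -> : \sum_(a : arrow Q) (x (tail a))%:Z * (y (Defs.head a))%:Z
          = (arrow_form x y)%:Z.
  by rewrite /arrow_form (big_morph Posz PoszD (erefl _)).
by rewrite expfzDr ?q_neq0 // -invr_expz.
Qed.

Lemma r1E x : r1 F x = qr1 F x.
Proof.
rewrite /r1 /qr1; congr (_ / _%:R).
  rewrite -natrX; congr _%:R.
  have := @card_dep_ffun (arrow Q) (fun a => 'M[F]_(x (tail a), x (Defs.head a))).
  rewrite foldrE big_map big_enum => ->.
  by rewrite expn_sum; apply: eq_bigr => a _; rewrite card_mx.
by rewrite -card_qunit; apply: eq_card => g; rewrite inE.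
Qed.

Lemma r2E x y : r2 F x y = qr2 F x y.
Proof. by rewrite /r2 eulerE !r1E. Qed.

End Comparison.

Section PairCount.
Variables (Q : quiver) (F : finFieldType) (pos : pred (dimvec Q)).
Variables (K : nat) (alpha gamma : dimvec Q).

Definition weighted_Gr (M : rep F alpha) : rat :=
  \sum_(L : qmx F alpha | subrep (M : qrep F alpha) L && (sdim L == gamma))
     chain_sum pos K (M : qrep F alpha) (qfull F alpha).

Lemma weighted_Gr_iso M N : rep_iso M N -> weighted_Gr M = weighted_Gr N.
Proof.
case/existsP => g /andP[]; rewrite inE => /forallP gu /forallP gh.
have gf v : row_free (g v) by rewrite row_free_unit gu.
have hE a : M a *m g (Defs.head a) = g (tail a) *m N a by apply/eqP.
have cF : canonical (qfull F alpha) by apply/forallP => v; rewrite ffunE genmx1.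
have pF : push (fun v => g v) (qfull F alpha) = qfull F alpha.
  apply: canonicalP => // [|v]; first exact: canonical_gen.
  rewrite !ffunE mul1mx; apply: eqmx_trans (genmxE _) _.
  by apply/eqmxP; rewrite submx1 sub1mx row_full_unit gu.
have pK (Y : qmx F alpha) : canonical Y ->
    push (fun v => g v) (pull (fun v => g v) Y) = Y.
  by move=> cY; apply: pullK => // v; rewrite submx_full // row_full_unit gu.
rewrite /weighted_Gr [RHS](reindex_bij _ (h := push (fun v => g v))
  (h' := pull (fun v => g v))
  (Q := fun L => subrep (M : qrep F alpha) L && (sdim L == gamma))).
- apply: eq_bigr => L _.
  by rewrite (chain_sum_push pos gf hE) // pF.
- move=> L /andP[sL dL]; have /andP[cL _] := sL; split; last exact: pK.
  have cP : canonical (pull (fun v => g v) L) by apply: canonical_gen.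
  by rewrite -(subrep_push gf hE) // -(sdim_push gf) pK // sL.
move=> L /andP[sL dL]; have /andP[cL _] := sL.
by rewrite (subrep_push gf hE) // (sdim_push gf) sL dL pushK.
Qed.

Lemma sum_weighted_Gr :
  dv_le gamma alpha ->
  \sum_(M in iso_reps F alpha) weighted_Gr M / (aut_card M)%:R
  = pair_chain_sum F pos K alpha gamma.
Proof.
move=> /forallP le; rewrite sum_iso_reps; last exact: weighted_Gr_iso.
rewrite /pair_chain_sum -(@full_chain_sumE _ _ pos K alpha) => [|v]; last first.
  by rewrite dv_subE subnKC.
congr (_ / _%:R); last by rewrite -card_qunit; apply: eq_card => g; rewrite inE.
apply: eq_bigr => M _; apply: eq_bigl => L; congr (_ && (_ == _)).
by apply/ffunP => v; rewrite ffunE.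
Qed.

End PairCount.

(** * The formula *)

Section RightHandSide.
Variables (Q : quiver) (F : finFieldType) (mu : slope Q) (alpha gamma : dimvec Q).
Hypothesis alpha0 : alpha != 0.

Let pos : pred (dimvec Q) := fun x => 0 < slope_excess mu alpha x.

(** As the function f is additive and vanishes at alpha, a partial sum has slope
below mu(alpha) exactly when the complementary sum is destabilizing. *)
Lemma flag_type_admissible s (d : {ffun 'I_s -> subdim alpha})
    (c : {ffun 'I_s -> subdim gamma}) :
  flag_type pos alpha gamma [ffun i => (d i, c i)] =
  admissible mu d && compatible d c.
Proof.
rewrite /flag_type /admissible /compatible.
under eq_bigr => i _ do rewrite ffunE.
under [X in _ && ((X == gamma) && _)]eq_bigr => i _ do rewrite ffunE.
rewrite /part_dim /part_sub /=.
have [sd | _] := eqVneq (\sum_(i < s) dv_of (d i)) alpha => //=.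
have -> : [forall i, (dv_of ([ffun i => (d i, c i)] i).1 != 0) &&
    dv_le (dv_of ([ffun i => (d i, c i)] i).2) (dv_of ([ffun i => (d i, c i)] i).1)]
  = [forall i, dv_of (d i) != 0] && [forall i, dv_le (dv_of (c i)) (dv_of (d i))].
  apply/forallP/andP => [P | [/forallP P1 /forallP P2] i]; last by rewrite ffunE P1 P2.
  by split; apply/forallP => i; have := P i; rewrite ffunE => /andP[].
have [d0 | _] := boolP [forall i, dv_of (d i) != 0]; last by rewrite /= !andbF.
rewrite /= [RHS]andbC -!andbA; congr [&& _, _ & _].
apply: eq_forallb => k; have [k0 | //] := ltnP 0 k.
rewrite (eq_bigr (fun l => dv_of (d l))) => [|l _]; last by rewrite ffunE.
set A := \sum_(l < s | (l < k)%N) _; set B := \sum_(l < s | (k <= l)%N) _.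
have AB : A + B = alpha.
  rewrite -sd (bigID (fun l : 'I_s => (l < k)%N)) /=; congr (_ + _).
  by apply: eq_bigl => l; rewrite -leqNgt.
have A0 : A != 0.
  pose i0 := Ordinal (leq_ltn_trans (leq0n k) (ltn_ord k) : 0 < s)%N.
  have := forallP d0 i0; apply: contra => /eqP/ffunP Az; apply/eqP/ffunP => v.
  have := Az v; rewrite dv_sumE !ffunE => /eqP.
  by rewrite sum_nat_eq0 => /forallP/(_ i0)/implyP/(_ k0)/eqP; rewrite ffunE.
rewrite /= slope_val_lt // /pos.
have := slope_excess_self mu alpha; rewrite -{2}AB slope_excessD => /eqP.
by rewrite addrC addr_eq0 => /eqP ->; rewrite oppr_gt0.
Qed.

End RightHandSide.

Theorem corollary4p2 (Q : quiver) (F : finFieldType) (mu : slope Q)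
    (alpha gamma : dimvec Q) (alpha_neq0 : alpha != 0)
    (gamma_le_alpha : dv_le gamma alpha) :
  \sum_(M in iso_reps F alpha | semistable mu M)
     (#|Gr gamma M|%:R / (aut_card M)%:R : rat)
  = \sum_(1 <= s < (dv_total alpha).+1)
    \sum_(d : {ffun 'I_s -> subdim alpha} | admissible mu d)
    \sum_(c : {ffun 'I_s -> subdim gamma} | compatible d c)
      let a i := dv_of (d i) in
      let g i := dv_of (c i) in
      let b i := dv_sub (a i) (g i) in
      (-1) ^+ s.-1
      * (\prod_(i < s) \prod_(j < s | (i < j)%N)
           (euler F (g i) (b j) / euler F (a i) (a j)))
      * \prod_(k < s) r2 F (b k) (g k).
Proof.
pose pos : pred (dimvec Q) := fun x => 0 < slope_excess mu alpha x.
pose K := dv_total alpha.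
have K0 : (0 < K)%N.
  rewrite lt0n sum_nat_eq0; apply: contra alpha_neq0 => /forallP z.
  by apply/eqP/ffunP => v; rewrite [RHS]ffunE; apply/eqP/(implyP (z v)).
have full_dim : sdim (qfull F alpha) = alpha.
  by apply/ffunP => v; rewrite !ffunE mxrank1.
transitivity (pair_chain_sum F pos K alpha gamma).
  rewrite -sum_weighted_Gr // [LHS]big_mkcondr /=; apply: eq_bigr => M _.
  have css : chain_sum pos K (M : qrep F alpha) (qfull F alpha) = (semistable mu M)%:R.
    rewrite semistableE // chain_sum_full //.
    - exact: slope_excessD.
    - by rewrite full_dim slope_excess_self.
    by apply: leq_sum => v _; rewrite ffunE mxrank1.
  rewrite /weighted_Gr css; case: ifP => _; last by rewrite big1 ?mul0r.
  rewrite sumr_const; congr (_%:R / _); apply: eq_card => L.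
  by rewrite !inE.
rewrite (@pair_chain_sum_flags _ _ _ alpha gamma) //; first last.
- exact/forallP.
- exact/forallP.
- by rewrite /pos slope_excess0 ltxx.
rewrite big_add1 big_mkord; apply: eq_bigr => s _.
rewrite /flag_sum mulr_sumr pair_big_dep /=.
rewrite (reindex_bij _
  (h := fun dc : {ffun 'I_s.+1 -> subdim alpha} * {ffun 'I_s.+1 -> subdim gamma} =>
          [ffun i => (dc.1 i, dc.2 i)])
  (h' := fun e => ([ffun i => (e i).1], [ffun i => (e i).2]))
  (Q := fun dc => admissible mu dc.1 && compatible dc.1 dc.2)).
- apply: eq_bigr => -[d c] _ /=; rewrite /flag_term -mulrA; congr (_ * (_ * _)).
    apply: eq_bigr => i _; apply: eq_bigr => j _.
    by rewrite !ffunE !eulerE.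
  by apply: eq_bigr => k _; rewrite !ffunE r2E.
- move=> e te.
  have eE : [ffun i => ([ffun i => (e i).1] i, [ffun i => (e i).2] i)] = e.
    by apply/ffunP => i; rewrite !ffunE -surjective_pairing.
  by split=> //=; rewrite -flag_type_admissible //= eE.
move=> [d c] /= dc; split; first by rewrite flag_type_admissible.
by congr (_, _); apply/ffunP => i; rewrite !ffunE.
Qed.
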